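(* Let $R=\mathbb{C}[x,y,z]$ and $J=(yz(y-z),\,zx(z-x),\,xy(x-y))\subseteq R$. Then $\rho(J)=\widehat{\rho}(J)=\frac{6}{5}$.
   Context: $I^{(m)}=\bigcap_{\mathfrak p\in \operatorname{Ass}(R/I)} (I^mR_{\mathfrak p}\cap R)$ is the $m$-th symbolic power. The resurgence is $\rho(I)=\sup\{m/r : I^{(m)}\not\subseteq I^r\}$ and the asymptotic resurgence is $\widehat{\rho}(I)=\sup\{m/r : I^{(mt)}\not\subseteq I^{rt}\text{ for all } t\gg 0\}$. *)

(* Defs.v *)
From Stdlib Require Import Reals.
From mathcomp Require Import all_boot all_algebra.
From mathcomp Require Import Rstruct complex.
From mathcomp Require Import mpoly.
Set Implicit Arguments. Unset Strict Implicit. Unset Printing Implicit Defensive.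
Import GRing.Theory.
Local Open Scope ring_scope.

Section Ideals.
Variable T : comNzRingType.

Definition subsetI (A B : T -> Prop) : Prop := forall f, A f -> B f.

Definition is_ideal (I : T -> Prop) : Prop :=
  I 0 /\ (forall a b, I a -> I b -> I (a + b)) /\ (forall r a, I a -> I (r * a)).

Definition ideal_gen (S : T -> Prop) : T -> Prop :=
  fun f => exists (n : nat) (a g : 'I_n -> T),
    (forall i, S (g i)) /\ f = \sum_(i < n) a i * g i.

Definition ideal_pow (I : T -> Prop) (r : nat) : T -> Prop :=
  ideal_gen (fun f => exists g : 'I_r -> T, (forall i, I (g i)) /\ f = \prod_(i < r) g i).

Definition prime_ideal (P : T -> Prop) : Prop :=
  is_ideal P /\ ~ P 1 /\ (forall a b, P (a * b) -> P a \/ P b).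

Definition associated_prime (I P : T -> Prop) : Prop :=
  prime_ideal P /\ exists f : T, forall g, P g <-> I (g * f).

(* contraction to R of the extension I R_P:  { f | exists s notin P, s f in I } *)
Definition contr_loc (I P : T -> Prop) : T -> Prop :=
  fun f => exists s, ~ P s /\ I (s * f).

Definition symb_pow (I : T -> Prop) (m : nat) : T -> Prop :=
  fun f => forall P, associated_prime I P -> contr_loc (ideal_pow I m) P f.

Definition resurgence_set (I : T -> Prop) : R -> Prop :=
  fun q => exists m r : nat, (0 < m)%N /\ (0 < r)%N /\
    ~ subsetI (symb_pow I m) (ideal_pow I r) /\ q = Rdiv (INR m) (INR r).

Definition asym_resurgence_set (I : T -> Prop) : R -> Prop :=
  fun q => exists m r : nat, (0 < m)%N /\ (0 < r)%N /\
    (exists t0 : nat, forall t : nat, (t0 <= t)%N ->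
       ~ subsetI (symb_pow I (m * t)) (ideal_pow I (r * t))) /\
    q = Rdiv (INR m) (INR r).

Definition resurgence_is (I : T -> Prop) (v : R) : Prop := is_lub (resurgence_set I) v.
Definition asym_resurgence_is (I : T -> Prop) (v : R) : Prop :=
  is_lub (asym_resurgence_set I) v.

End Ideals.

Definition Cc : comNzRingType := Rdefinitions.R[i].
Definition Rxyz := {mpoly Cc[3]}.
Definition vx : Rxyz := 'X_(0 : 'I_3).
Definition vy : Rxyz := 'X_(1 : 'I_3).
Definition vz : Rxyz := 'X_(2 : 'I_3).

Definition J : Rxyz -> Prop :=
  ideal_gen (fun f => f = vy * vz * (vy - vz) \/ f = vz * vx * (vz - vx)
                      \/ f = vx * vy * (vx - vy)).

(* Main.v *)
(* The ideal defines seven reduced points of the plane, the nonzero 0/1 vectors [p_A].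

   Upper bound: let [f] be homogeneous of degree [d] in the [m]-th symbolic power, hence
   vanishing to order [m] at the seven points. Restricted to a general member of a pencil
   of rational quartics with double points at the three [p_A] with [#|A| = 2], passing
   through the other four, it has [10 m] zeros, so [5 m <= 2 d]; if [6 r < 5 m] this
   gives [d > 3 r]. A form of degree [d > 3 r] vanishing to order [r] at the points lies
   in the [r]-th power: write it as a form [C(g1, g2, g3)] of degree [r - 1] in the cubics.
   Vanishing to order [r] at [p] forces [C(p; T)] to be divisible by [p . T], and so
   subtracting from [C] a multiple of the linear syzygy [x T1 + y T2 + z T3] makes all its
   coefficients vanish at the seven points, i.e. lie in the ideal; the multiplier exists
   because forms of degree at least 3 separate the seven points.

   Lower bound: the six lines through three of the seven points, doubled, and the three
   lines joining the [p_A] with [#|A| = 2] have together degree 15 and multiplicity 6 at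
   every point, while the [r]-th power starts in degree [3 r]. *)
Require Import Defs.
From Stdlib Require Import Reals Lra Classical.
From mathcomp Require Import all_boot all_order all_algebra.
From mathcomp Require Import Rstruct complex.
From mathcomp Require Import mpoly ring zify.
Set Implicit Arguments. Unset Strict Implicit. Unset Printing Implicit Defensive.
Import Order.TTheory GRing.Theory Num.Theory.
Local Open Scope ring_scope.

(** * Ideals and their powers *)

Section IdealTheory.
Variable T : comNzRingType.
Implicit Types (S I : T -> Prop) (a b f : T).

Lemma ideal_sum (I : T -> Prop) (X : Type) (s : seq X) (F : X -> T) :
  is_ideal I -> (forall x, I (F x)) -> I (\sum_(x <- s) F x).
Proof. by move=> [I0 [ID _]] IF; elim/big_ind: _. Qed.

Lemma ideal_sum_seq (I : T -> Prop) (X : eqType) (s : seq X) (F : X -> T) :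
  is_ideal I -> (forall x, x \in s -> I (F x)) -> I (\sum_(x <- s) F x).
Proof.
by move=> [I0 [ID _]] IF; rewrite big_seq; elim/big_ind: _.
Qed.

Lemma ideal_mulr I a b : is_ideal I -> I a -> I (a * b).
Proof. by move=> [_ [_ IM]] Ia; rewrite mulrC; apply: IM. Qed.

Lemma ideal_opp I a : is_ideal I -> I a -> I (- a).
Proof. by move=> [_ [_ IM]] Ia; rewrite -mulN1r; apply: IM. Qed.

Lemma ideal_sub I a b : is_ideal I -> I a -> I b -> I (a - b).
Proof. by move=> idI Ia Ib; apply: (idI.2.1) => //; apply: ideal_opp. Qed.

Lemma ideal_gen_ideal S : is_ideal (ideal_gen S).
Proof.
split; first by exists 0%N, (fun=> 0), (fun=> 0); split; [case | rewrite big_ord0].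
split=> [a b [n1 [a1 [g1 [S1 ->]]]] [n2 [a2 [g2 [S2 ->]]]]|r a [n [a1 [g1 [S1 ->]]]]].
  exists (n1 + n2)%N,
    (fun i => match split i with inl j => a1 j | inr j => a2 j end),
    (fun i => match split i with inl j => g1 j | inr j => g2 j end).
  split; first by move=> i; case: (split i).
  rewrite big_split_ord /=; congr (_ + _); apply: eq_bigr => i _.
    by rewrite -[lshift _ i]/(unsplit (inl i)) unsplitK.
  by rewrite -[rshift _ i]/(unsplit (inr i)) unsplitK.
exists n, (fun i => r * a1 i), g1; split=> //.
by rewrite mulr_sumr; apply: eq_bigr => i _; rewrite mulrA.
Qed.

Lemma ideal_gen_mem S a : S a -> ideal_gen S a.
Proof.
by move=> Sa; exists 1%N, (fun=> 1), (fun=> a); split=> //; rewrite big_ord1 mul1r.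
Qed.

Lemma ideal_gen_min S I : is_ideal I -> (forall x, S x -> I x) ->
  forall x, ideal_gen S x -> I x.
Proof.
move=> idI SI x [n [a [g [Sg ->]]]]; apply: ideal_sum => // i.
by apply: (idI.2.2); apply: SI.
Qed.

Lemma ideal_pow_ideal I r : is_ideal (ideal_pow I r).
Proof. exact: ideal_gen_ideal. Qed.

Lemma ideal_pow0 I a : ideal_pow I 0 a.
Proof.
rewrite -[a]mulr1; apply: (ideal_pow_ideal _ _).2.2; apply: ideal_gen_mem.
by exists (fun=> 0); split; [case | rewrite big_ord0].
Qed.

Lemma ideal_powS I r a b : I a -> ideal_pow I r b -> ideal_pow I r.+1 (a * b).
Proof.
move=> Ia; apply: (@ideal_gen_min _ (fun b => ideal_pow I r.+1 (a * b))).
  have [I0 [ID IM]] := ideal_pow_ideal I r.+1.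
  by split=> [|]; [rewrite mulr0 | split=> [x y Ix Iy|c x Ix];
    [rewrite mulrDr; apply: ID | rewrite mulrCA; apply: IM]].
move=> _ [g [Ig ->]]; apply: ideal_gen_mem.
exists (fun i => if unlift ord0 i is Some j then g j else a); split.
  by move=> i; case: unliftP.
rewrite big_ord_recl unlift_none; congr (_ * _).
by apply: eq_bigr => i _; rewrite liftK.
Qed.

Lemma ideal_pow_mul I m n a b :
  ideal_pow I m a -> ideal_pow I n b -> ideal_pow I (m + n) (a * b).
Proof.
move=> Ia Ib; move: a Ia; apply: ideal_gen_min.
  have [I0 [ID IM]] := ideal_pow_ideal I (m + n).
  by split=> [|]; [rewrite mul0r | split=> [x y Ix Iy|c x Ix];
    [rewrite mulrDl; apply: ID | rewrite -mulrA; apply: IM]].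
move=> _ [g [Ig ->]]; elim: m g Ig => [|m IHm] g Ig; first by rewrite big_ord0 mul1r.
by rewrite big_ord_recl -mulrA addSn; apply: ideal_powS => //; apply: IHm => i.
Qed.

Lemma ideal_pow_exp I m n a : ideal_pow I m a -> ideal_pow I (m * n) (a ^+ n).
Proof.
move=> Ia; elim: n => [|n IHn]; first by rewrite muln0; apply: ideal_pow0.
by rewrite exprS mulnS; apply: ideal_pow_mul.
Qed.

Lemma ideal_pow1 I a : I a -> ideal_pow I 1 a.
Proof. by move=> Ia; rewrite -[a]mulr1; apply: ideal_powS => //; apply: ideal_pow0. Qed.

(** With [u] a local parameter this turns membership into order of vanishing; with [u = 'X^3] it
    shows that the [r]-th power of the ideal starts in degree [3 * r]. *)
Lemma ideal_pow_map (A : comNzRingType) (phi : {rmorphism T -> A}) (u : A) I r :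
  (forall a, I a -> exists q, phi a = u * q) ->
  forall f, ideal_pow I r f -> exists q, phi f = u ^+ r * q.
Proof.
move=> Iu f; apply: (@ideal_gen_min _ (fun f => exists q, phi f = u ^+ r * q)).
  split; first by exists 0; rewrite rmorph0 mulr0.
  split=> [a b [qa ea] [qb eb]|c a [q e]].
    by exists (qa + qb); rewrite rmorphD ea eb mulrDr.
  by exists (phi c * q); rewrite rmorphM e mulrCA.
move=> _ [g [Ig ->]]; rewrite rmorph_prod.
elim: r g Ig => [|r IHr] g Ig; first by exists 1; rewrite big_ord0 mulr1.
have [q e] := Iu _ (Ig ord0); have [i|q' e'] := IHr (fun i => g (lift ord0 i)).
  exact: Ig.
by exists (q * q'); rewrite big_ord_recl e e' exprS mulrACA.
Qed.

End IdealTheory.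

(** * Evaluation of polynomials and homogeneous components *)

Section Evaluation.
Variables (n : nat) (K : comNzRingType).
Implicit Types (f : {mpoly K[n]}).

Lemma rmorph_mmap (A B : comNzRingType) (phi : {rmorphism K -> A})
    (psi : {rmorphism A -> B}) (h : 'I_n -> A) f :
  psi (mmap phi h f) = mmap (psi \o phi) (psi \o h) f.
Proof.
rewrite /mmap rmorph_sum; apply: eq_bigr => m _.
rewrite rmorphM rmorph_prod; congr (_ * _); apply: eq_bigr => i _.
by rewrite rmorphXn.
Qed.

Lemma eq_mmap (A : nzRingType) (phi psi : K -> A) (h k : 'I_n -> A) f :
  phi =1 psi -> h =1 k -> mmap phi h f = mmap psi k f.
Proof.
move=> e1 e2; rewrite /mmap; apply: eq_bigr => m _; rewrite e1.
by congr (_ * _); apply: eq_bigr => i _; rewrite e2.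
Qed.

Lemma mmap_homog (A : comNzRingType) (phi : {rmorphism K -> A}) (c : A)
    (h : 'I_n -> A) d f :
  f \is d.-homog -> mmap phi (fun i => c * h i) f = c ^+ d * mmap phi h f.
Proof.
move=> /dhomogP homf; rewrite /mmap mulr_sumr !big_seq; apply: eq_bigr => m /homf <-.
rewrite /mmap1 mulrCA; congr (_ * _).
rewrite (eq_bigr (fun i => c ^+ m i * h i ^+ m i)) => [|i _]; last exact: exprMn.
by rewrite big_split /= prodrXr -mdegE.
Qed.

Lemma mmap_pihomog (A : comNzRingType) (phi : {rmorphism K -> A}) (c : A)
    (h : 'I_n -> A) f :
  mmap phi (fun i => c * h i) f
  = \sum_(d < msize f) c ^+ d * mmap phi h (pihomog mdeg d f).
Proof.
rewrite {1}(@pihomog_partitionE _ _ mdeg (msize f) f (leqnn _)) raddf_sum.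
by apply: eq_bigr => d _; apply: mmap_homog; apply: pihomogP.
Qed.

Lemma pihomogM (mf : measure n) d e f g : f \is d.-homog for mf ->
  pihomog mf (d + e) (f * g) = f * pihomog mf e g.
Proof.
move=> homf; rewrite {1}(@pihomog_partitionE _ _ mf (maxn e.+1 (mmeasure mf g)) g (leq_maxr _ _)).
have lt_e : (e < maxn e.+1 (mmeasure mf g))%N by rewrite leq_max ltnSn.
rewrite mulr_sumr raddf_sum (bigD1 (Ordinal lt_e)) //= pihomog_dE; last first.
  exact/dhomogM/pihomogP.
rewrite big1 ?addr0 // => i; rewrite -val_eqE /= => ne_ie.
by apply: (@pihomog_ne0 _ _ _ (d + i)); [rewrite eqn_add2l | exact/dhomogM/pihomogP].
Qed.

End Evaluation.

(** * The seven points *)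

Lemma sum_ord3 (V : nmodType) (F : 'I_3 -> V) : \sum_i F i = F 0 + F 1 + F 2.
Proof.
rewrite 3!big_ord_recr big_ord0 /= add0r.
by congr (F _ + F _ + F _); apply: val_inj.
Qed.

Section SevenPoints.
Variable K : comNzRingType.
Implicit Types (f : {mpoly K[3]}) (A B : {set 'I_3}).

Definition seven_ideal : {mpoly K[3]} -> Prop :=
  ideal_gen (fun f => f = 'X_1 * 'X_2 * ('X_1 - 'X_2) \/ f = 'X_2 * 'X_0 * ('X_2 - 'X_0)
                      \/ f = 'X_0 * 'X_1 * ('X_0 - 'X_1)).

(* The seven points of the plane defined by [seven_ideal] are exactly the
   nonzero 0/1 vectors, i.e. the indicators of the nonempty subsets of ['I_3]. *)
Definition pt (A : {set 'I_3}) : 'I_3 -> K := fun i => (i \in A)%:R.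

Definition cubic (i : 'I_3) : {mpoly K[3]} :=
  'X_(i + 1) * 'X_(i + 2) * ('X_(i + 1) - 'X_(i + 2)).

Lemma ord3_ind (P : 'I_3 -> Prop) : P 0 -> P 1 -> P 2 -> forall i, P i.
Proof.
move=> P0 P1 P2 [[|[|[|//]]] lt_i].
- by rewrite (_ : Ordinal lt_i = 0) //; apply: val_inj.
- by rewrite (_ : Ordinal lt_i = 1) //; apply: val_inj.
- by rewrite (_ : Ordinal lt_i = 2) //; apply: val_inj.
Qed.

Lemma ord3_add : (((0 + 1)%R = 1%R :> 'I_3) * ((0 + 2)%R = 2%R :> 'I_3)
  * ((1 + 1)%R = 2%R :> 'I_3) * ((1 + 2)%R = 0%R :> 'I_3)
  * ((2 + 1)%R = 0%R :> 'I_3) * ((2 + 2)%R = 1%R :> 'I_3))%type.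
Proof. by do !split; apply: val_inj. Qed.

Lemma seven_idealE f : seven_ideal f <-> ideal_gen (fun g => exists i, g = cubic i) f.
Proof.
split; apply: ideal_gen_min => [|g]; try exact: ideal_gen_ideal.
  case=> [->|[]->]; apply: ideal_gen_mem; [exists 0 | exists 1 | exists 2];
    by rewrite /cubic !ord3_add.
case=> i ->; apply: ideal_gen_mem; elim/ord3_ind: i;
  rewrite /cubic !ord3_add; tauto.
Qed.

Lemma seven_ideal_ideal : is_ideal seven_ideal.
Proof. exact: ideal_gen_ideal. Qed.
Hint Resolve seven_ideal_ideal : core.

Lemma seven_ideal_cubic i : seven_ideal (cubic i).
Proof. by apply/seven_idealE; apply: ideal_gen_mem; exists i. Qed.

Lemma seven_ideal_var i j : seven_ideal ('X_i * 'X_j * ('X_i - 'X_j)).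
Proof.
have g0 := seven_ideal_cubic 0; have g1 := seven_ideal_cubic 1.
have g2 := seven_ideal_cubic 2; rewrite /cubic !ord3_add in g0 g1 g2.
have Jii k : seven_ideal ('X_k * 'X_k * ('X_k - 'X_k)).
  by rewrite subrr mulr0; apply: seven_ideal_ideal.1.
have Jsym k l : seven_ideal ('X_k * 'X_l * ('X_k - 'X_l)) ->
    seven_ideal ('X_l * 'X_k * ('X_l - 'X_k)).
  by move=> /(ideal_opp seven_ideal_ideal); rewrite -mulrN opprB [X in X * _]mulrC.
by elim/ord3_ind: i; elim/ord3_ind: j; auto.
Qed.

Lemma seven_ideal_map (A : comNzRingType) (phi : {rmorphism {mpoly K[3]} -> A}) (u : A) :
  (forall i j, exists q, phi ('X_i * 'X_j * ('X_i - 'X_j)) = u * q) ->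
  forall f, seven_ideal f -> exists q, phi f = u * q.
Proof.
move=> Hu f /seven_idealE; move: f.
apply: (@ideal_gen_min _ _ (fun f => exists q, phi f = u * q)); last first.
  by move=> _ [i ->]; apply: Hu.
split; first by exists 0; rewrite rmorph0 mulr0.
split=> [a b [qa ea] [qb eb]|c a [q e]].
  by exists (qa + qb); rewrite rmorphD ea eb mulrDr.
by exists (phi c * q); rewrite rmorphM e mulrCA.
Qed.

(* At a point with 0/1 coordinates one of the three factors of each generator vanishes. *)
Lemma seven_ideal_near_pt (S : comNzRingType) (phi : {rmorphism K -> S}) A (c u : S)
    (w : 'I_3 -> S) f : seven_ideal f ->
  exists q, mmap phi (fun i => c * phi (pt A i) + u * w i) f = u * q.
Proof.
move: f; apply: seven_ideal_map => i j.
rewrite !rmorphM rmorphB /= !mmapX !mmap1U /pt.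
case: (i \in A); case: (j \in A); rewrite ?rmorph1 ?rmorph0 ?mulr1 ?mulr0 ?add0r.
- by exists ((c + u * w i) * (c + u * w j) * (w i - w j)); ring.
- by exists ((c + u * w i) * w j * (c + u * w i - u * w j)); ring.
- by exists (w i * (c + u * w j) * (u * w i - (c + u * w j))); ring.
- by exists (w i * (u * w j) * (u * w i - u * w j)); ring.
Qed.

Definition mnm_supp (m : 'X_{1..3}) : {set 'I_3} := [set i | m i != 0%N].

(** At a 0/1 vector a monomial takes the value 1 if its support lies in [A] and 0 otherwise. *)
Lemma meval_pt f A :
  f.@[pt A] = \sum_(m <- msupp f | mnm_supp m \subset A) f@_m.
Proof.
rewrite mevalE [RHS]big_mkcond; apply: eq_bigr => m _.
case: ifPn => [/subsetP sA|/subsetPn[j]]; last first.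
  rewrite inE => mj jA; rewrite (bigD1 j) //= /pt (negbTE jA) expr0n (negbTE mj).
  by rewrite mul0r mulr0.
rewrite big1 ?mulr1 // => i _; rewrite /pt; case: (boolP (i \in A)) => iA; first exact: expr1n.
have: i \notin mnm_supp m by apply: contra iA; apply: sA.
by rewrite inE negbK => /eqP ->.
Qed.

Definition prod_vars A : {mpoly K[3]} := \prod_(i in A) 'X_i.

Lemma prod_vars_subX A i j : i \in A -> j \in A ->
  seven_ideal (prod_vars A * ('X_i - 'X_j)).
Proof.
move=> iA jA; have [->|ne_ij] := eqVneq i j.
  by rewrite subrr mulr0; apply: seven_ideal_ideal.1.
rewrite /prod_vars (bigD1 i) //= (bigD1 j) /=; last by rewrite jA eq_sym.
set r := \prod_(k | _) _; rewrite (_ : _ * _ = r * ('X_i * 'X_j * ('X_i - 'X_j))); last by ring.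
by apply: seven_ideal_ideal.2.2; apply: seven_ideal_var.
Qed.

(** After multiplication by [prod_vars A] the variables indexed by [A] become interchangeable modulo
    the ideal, and this congruence [E] is multiplicative. *)
Lemma prod_vars_subXm A i (m : 'X_{1..3}) : i \in A -> mnm_supp m \subset A ->
  seven_ideal (prod_vars A * ('X_[m] - 'X_i ^+ mdeg m)).
Proof.
move=> iA /subsetP sA; pose E p q := seven_ideal (prod_vars A * (p - q)).
have EM p q p' q' : E p q -> E p' q' -> E (p * p') (q * q').
  move=> Ep Eq; rewrite /E.
  rewrite (_ : _ * _ = prod_vars A * (p - q) * p' + q * (prod_vars A * (p' - q'))); last by ring.
  by apply: seven_ideal_ideal.2.1; [apply: ideal_mulr | apply: seven_ideal_ideal.2.2].
have E1 p : E p p by rewrite /E subrr mulr0; apply: seven_ideal_ideal.1.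
have EX p q k : E p q -> E (p ^+ k) (q ^+ k).
  by move=> Ep; elim: k => [|k IHk]; rewrite ?expr0 // !exprS; apply: EM.
rewrite -/(E _ _) mpolyXE_id mdegE -prodrXr.
apply: (big_ind2 E) => // j _; case: (eqVneq (m j) 0%N) => [-> //|mj].
by apply: EX; apply: prod_vars_subX => //; apply: sA; rewrite inE.
Qed.

(** Common representative, modulo the ideal, of the monomials of degree [d] and support [A]; the
    default 1 serves the constant monomial, the only one with empty support. *)
Definition std_mon d A : {mpoly K[3]} :=
  if [pick i in A] is Some i then prod_vars A * 'X_i ^+ (d - #|A|) else 1.

Lemma std_mon_congr m : seven_ideal ('X_[m] - std_mon (mdeg m) (mnm_supp m)).
Proof.
rewrite /std_mon; case: pickP => [i iA|A0]; last first.
  rewrite (_ : m = 0%MM) ?mpolyX0 ?subrr; first exact: seven_ideal_ideal.1.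
  by apply/mnmP => i; rewrite mnm0E; move: (A0 i); rewrite inE => /negbFE/eqP.
(* Split off one copy of each variable of the support; the cofactor is still supported there. *)
pose mA : 'X_{1..3} := [multinom (i \in mnm_supp m : nat) | i < 3].
have le_mA : (mA <= m)%MM.
  by apply/mnm_lepP => j; rewrite mnmE inE; case: (m j).
have eA : prod_vars (mnm_supp m) = 'X_[mA].
  rewrite mpolyXE_id /prod_vars [LHS]big_mkcond; apply: eq_bigr => j _.
  by rewrite mnmE; case: ifP; rewrite ?expr1 ?expr0.
have dA : mdeg mA = #|mnm_supp m|.
  by rewrite mdegE -sum1_card [RHS]big_mkcond; apply: eq_bigr => j _; rewrite mnmE; case: ifP.
have dm : (mdeg m - #|mnm_supp m|)%N = mdeg (m - mA)%MM.
  by rewrite -{1}(submK le_mA) mdegD dA addnK.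
rewrite dm -{1}(submK le_mA) mpolyXD -eA [X in X - _]mulrC -mulrBr.
apply: prod_vars_subXm => //; apply/subsetP => j; rewrite !inE mnmBE.
by apply: contraNneq => ->.
Qed.

(** Modulo the ideal a monomial depends only on its degree and support, so [f] reduces to standard
    monomials with coefficients [s A]. The values at the points are the sums of [s] over subsets,
    and Moebius inversion makes every [s A] vanish. *)
Lemma homog_vanish_seven_ideal d f : f \is d.-homog ->
  (forall A, A != set0 -> f.@[pt A] = 0) -> seven_ideal f.
Proof.
move=> homf f0.
(* The origin is 0 times [pt setT], so homogeneity covers the empty set as well. *)
have {}f0 A : f.@[pt A] = 0.
  have [->|] := eqVneq A set0; last exact: f0.
  rewrite (_ : f.@[_] = f.@[fun i => 0 * pt setT i]).
    rewrite /meval (mmap_homog _ _ _ homf) -/(meval _ _) f0 ?mulr0 //.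
    by apply/set0Pn; exists 0.
  by apply: meval_eq => i; rewrite mul0r /pt inE.
pose s A := \sum_(m <- msupp f | mnm_supp m == A) f@_m.
have sumE A : f.@[pt A] = \sum_(B : {set 'I_3} | B \subset A) s B.
  rewrite meval_pt (partition_big mnm_supp (fun B : {set 'I_3} => B \subset A)) //=.
  apply: eq_bigr => B sB; apply: eq_bigl => m.
  by case: eqP => [->|]; rewrite ?sB ?andbF.
have s0 A : s A = 0.
  move: {2}#|A|.+1 (ltnSn #|A|) => k; elim: k A => // k IHk A leA.
  have := f0 A; rewrite sumE (bigD1 A) //= big1 ?addr0 // => B /andP[sB neB].
  apply: IHk; rewrite -ltnS; apply: leq_trans leA; rewrite ltnS.
  by apply: proper_card; rewrite properEneq neB.
rewrite [f]mpolyE (eq_big_seq (fun m => f@_m *: ('X_[m] - std_mon (mdeg m) (mnm_supp m))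
   + f@_m *: std_mon d (mnm_supp m))); last first.
  by move=> m /(dhomogP _ _ _ homf) <-; rewrite -scalerDr subrK.
rewrite big_split /= (_ : \sum_(m <- _) f@_m *: std_mon d _ = 0) ?addr0.
  by apply: ideal_sum => // m; rewrite -mul_mpolyC; apply: seven_ideal_ideal.2.2;
    apply: std_mon_congr.
rewrite (partition_big mnm_supp predT) //= big1 // => A _.
rewrite (eq_bigr (fun m => f@_m *: std_mon d A)) => [|m /eqP -> //].
by rewrite -scaler_suml -/(s A) s0 scale0r.
Qed.

End SevenPoints.
#[global] Hint Resolve seven_ideal_ideal : core.
Arguments seven_ideal {K} _.

(** * Point ideals and orders of vanishing *)

Section PointIdeals.
Variable K : idomainType.
Implicit Types (f g : {mpoly K[3]}) (A B : {set 'I_3}).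

(** Scaling all variables by a new one makes its exponent record the degree. *)
Lemma coef_mmapX (n : nat) (S : comNzRingType) (phi : {rmorphism K -> S}) (h : 'I_n -> S)
    (f : {mpoly K[n]}) d :
  (mmap (polyC \o phi) (fun i => 'X * (h i)%:P) f)`_d = mmap phi h (pihomog mdeg d f).
Proof.
rewrite mmap_pihomog.
have -> : \sum_(e < msize f) 'X ^+ e * mmap (polyC \o phi) (fun i => (h i)%:P)
    (pihomog mdeg e f) = \poly_(e < msize f) mmap phi h (pihomog mdeg e f).
  rewrite poly_def; apply: eq_bigr => e _; rewrite -mul_polyC mulrC; congr (_ * _).
  by rewrite (rmorph_mmap _ polyC).
rewrite coef_poly; case: ltnP => // le_fd; rewrite pihomogE big_seq_cond big_pred0 ?mmap0 //.
by move=> m; apply/negbTE/andP => -[/msize_mdeg_lt ltm /eqP em]; rewrite em ltnNge le_fd in ltm.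
Qed.

(* The prime of the line through the origin and [pt A], as the kernel of the
   restriction to that line; [pt A] itself would not be enough for inhomogeneous [f]. *)
Definition point_ideal A f : Prop :=
  mmap polyC (fun i => 'X * (pt K A i)%:P) f = 0 :> {poly K}.

Lemma point_idealE A f :
  point_ideal A f <-> forall d, (pihomog mdeg d f).@[pt K A] = 0.
Proof.
have coefE d : (mmap polyC (fun i => 'X * (pt K A i)%:P) f : {poly K})`_d
    = (pihomog mdeg d f).@[pt K A].
  rewrite /meval -coef_mmapX; congr (_`_ _); exact: eq_mmap.
by split=> [f0 d|f0]; [rewrite -coefE f0 coef0 | apply/polyP => d; rewrite coefE f0 coef0].
Qed.

Lemma point_ideal_homog A d f : f \is d.-homog -> point_ideal A f <-> f.@[pt K A] = 0.
Proof.
move=> homf; rewrite point_idealE; split=> [/(_ d)|f0 e]; first by rewrite pihomog_dE.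
have [<-|ne_de] := eqVneq d e; first by rewrite pihomog_dE.
by rewrite (pihomog_ne0 ne_de homf) meval0.
Qed.

Lemma point_ideal_prime A : A != set0 -> prime_ideal (point_ideal A).
Proof.
move=> A0; split; [|split].
- split; first exact: rmorph0.
  split=> [a b ea eb|r a ea]; first by rewrite /point_ideal rmorphD /= ea eb addr0.
  by rewrite /point_ideal rmorphM /= ea mulr0.
- by rewrite /point_ideal rmorph1 => /eqP; rewrite oner_eq0.
- move=> a b; rewrite /point_ideal rmorphM => /eqP; rewrite mulf_eq0.
  by case/orP => /eqP; [left | right].
Qed.

Lemma seven_ideal_sub_point A f : seven_ideal f -> point_ideal A f.
Proof.
move=> /(seven_ideal_near_pt polyC A 'X 0 (fun=> 0)) [q f0].
rewrite /point_ideal (@eq_mmap _ _ _ _ polyC _ (fun i => 'X * (pt K A i)%:P + 0 * 0)) //.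
  by rewrite f0 mul0r.
by move=> i; rewrite mul0r addr0.
Qed.

Lemma seven_ideal_bigcap f : (forall A, A != set0 -> point_ideal A f) -> seven_ideal f.
Proof.
move=> f0; rewrite (@pihomog_partitionE _ _ mdeg (msize f) f (leqnn _)).
apply: ideal_sum => // d; apply: (homog_vanish_seven_ideal (pihomogP _ _ _)) => A.
by move/f0/point_idealE.
Qed.

Definition separator d A : {mpoly K[3]} :=
  if [pick i in A] is Some i then
    'X_i ^+ (d - 3) * \prod_(j < 3) (if j \in A then 'X_j else 'X_i - 'X_j)
  else 0.

Lemma separator_homog d A : (3 <= d)%N -> separator d A \is d.-homog.
Proof.
move=> le3d; rewrite /separator; case: pickP => [i iA|_]; last exact: dhomog0.
rewrite -{2}(subnK le3d); apply: dhomogM.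
  by rewrite -[X in X.-homog]mul1n; apply: dhomogMn; rewrite dhomogX /= mdeg1.
have homX k : ('X_k : {mpoly K[3]}) \is 1.-homog by rewrite dhomogX /= mdeg1.
rewrite 3!big_ord_recr big_ord0 /= mul1r -[3%N]/(1 + 1 + 1)%N.
by apply: dhomogM; [apply: dhomogM|]; case: ifP => _; rewrite ?rpredB.
Qed.

(** If the factors ['X_j] do not vanish, [A] is contained in [B]; then ['X_i] is 1 at [pt B], and
    the factors ['X_i - 'X_j] force [B] into [A]. *)
Lemma separator_pt d A B : A != set0 -> (separator d A).@[pt K B] = (A == B)%:R.
Proof.
move=> /set0Pn [i0 i0A]; rewrite /separator; case: pickP => [i iA|/(_ i0)]; last by rewrite i0A.
rewrite mevalM rmorphXn rmorph_prod /= mevalXU /pt.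
case: (eqVneq A B) => [<-|neAB].
  rewrite iA expr1n mul1r big1 // => j _; case: ifPn => [jA|jNA].
    by rewrite mevalXU jA.
  by rewrite mevalB !mevalXU iA (negbTE jNA) subr0.
have [AB|/subsetPn[j jA jB]] := boolP (A \subset B); last first.
  by rewrite (bigD1 j) //= jA mevalXU (negbTE jB) mul0r mulr0.
have /subsetPn[j jB jA] : ~~ (B \subset A) by apply: contra neAB => BA; rewrite eqEsubset AB.
by rewrite (bigD1 j) //= (negbTE jA) mevalB !mevalXU jB (subsetP AB _ iA) subrr mul0r mulr0.
Qed.

(** The cubic separator lies in the primes of the other six points but not in that of [A], so
    multiplying by it tests membership at [A] alone. *)
Lemma point_ideal_assoc A : A != set0 -> associated_prime seven_ideal (point_ideal A).
Proof.
move=> A0; split; first exact: point_ideal_prime.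
have [idA [_ primeA]] := point_ideal_prime A0.
exists (separator 3 A) => g; split=> [gA|].
  apply: seven_ideal_bigcap => B B0; have [idB _] := point_ideal_prime B0.
  have [<-|neAB] := eqVneq A B; first exact: ideal_mulr.
  apply: idB.2.2; apply/(point_ideal_homog _ (separator_homog A (leqnn 3))).
  by rewrite separator_pt // (negbTE neAB).
move=> /(seven_ideal_sub_point A) /primeA [//|].
move=> /(point_ideal_homog _ (separator_homog A (leqnn 3))).
by rewrite separator_pt // eqxx => /eqP; rewrite oner_eq0.
Qed.

(** Multiplicity at least [m] at the projective point [p], expressed without derivatives through
    arcs that pass through [p] where [u] vanishes. The varying scalar [c] lets a parametrised
    projective curve be inserted without normalisation. *)
Definition vanish_order (p : 'I_3 -> K) m f : Prop :=
  forall (c u : {poly K}) (w : 'I_3 -> {poly K}), c != 0 ->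
  exists q, mmap polyC (fun i => c * (p i)%:P + u * w i) f = u ^+ m * q.

Lemma vanish_order_leq p m n f : (n <= m)%N -> vanish_order p m f -> vanish_order p n f.
Proof.
move=> le_nm fm c u w c0; have [q ->] := fm c u w c0.
by exists (u ^+ (m - n) * q); rewrite mulrA -exprD subnKC.
Qed.

Lemma poly_cancel_dvdX (S : idomainType) m (a b q : {poly S}) :
  a`_0 != 0 -> a * b = 'X^m * q -> exists q', b = 'X^m * q'.
Proof.
move=> a0; elim: m q => [|m IHm] q; first by exists b; rewrite mul1r.
rewrite exprSr -mulrA => e; have [b' eb] := IHm _ e.
have e' : a * b' = 'X * q.
  apply: (@mulfI _ 'X^m); first by rewrite expf_neq0 // polyX_eq0.
  by rewrite mulrCA -eb.
exists (drop_poly 1 b'); rewrite -mulrA eb; congr (_ * _).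
rewrite -{1}(poly_take_drop 1 b') expr1 mulrC (_ : take_poly 1 b' = 0) ?add0r //.
apply/polyP => i; rewrite coef_take_poly coef0; case: ltnP => //.
rewrite ltnS leqn0 => /eqP ->; apply/eqP; have /(congr1 (fun p : {poly S} => p`_0)) := e'.
by rewrite coef0M coefXM /= => /eqP; rewrite mulf_eq0 (negbTE a0).
Qed.

(* Substitute [tau (c p + t w)] for the variables: [tau] separates the homogeneous
   components, and [s] becomes prime to [t], so it can be cancelled from [t ^ m]. *)
Lemma symb_pow_vanish_order m f d A : A != set0 ->
  symb_pow seven_ideal m f -> vanish_order (pt K A) m (pihomog mdeg d f).
Proof.
move=> A0 /(_ _ (point_ideal_assoc A0)) [s [sA sfm]] c u w c0.
(* The variable of [S1] is tau, over the ring containing [c], [u] and [w]; the variable of [S2] is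
   t, to be evaluated at [u] in the end. *)
pose S1 := {poly {poly K}}; pose S2 := {poly S1}.
pose phi : {rmorphism K -> S1} := polyC \o polyC.
pose C : S2 := ('X * c%:P)%:P; pose W i : S2 := ('X * (w i)%:P)%:P.
pose h i : S2 := C * (phi (pt K A i))%:P + 'X * W i.
have [q e] : exists q, mmap (polyC \o phi) h (s * f) = 'X^m * q.
  apply: (@ideal_pow_map _ _ (mmap (polyC \o phi) h) 'X seven_ideal) sfm => a.
  exact: seven_ideal_near_pt.
rewrite rmorphM /= in e.
(* At t = 0 the coefficient of tau^e' is [c ^+ e'] times the value at [pt A] of a component of [s];
   if all of these vanished, [s] would lie in the prime. *)
have s0 : (mmap (polyC \o phi) h s)`_0 != 0.
  apply/eqP => s0; apply: sA; apply/point_idealE => e'.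
  have e1 : mmap phi (fun i => 'X * (c * (pt K A i)%:P)%:P) s = 0.
    rewrite -[RHS]s0 -horner_coef0 -horner_evalE rmorph_mmap.
    apply: eq_mmap => [x|i] /=; rewrite /horner_eval ?hornerC //.
    by rewrite /h /C hornerD !hornerM hornerX mul0r addr0 !hornerC polyCM mulrA.
  have := congr1 (fun p : S1 => p`_e') e1.
  rewrite coef0 (coef_mmapX polyC) (mmap_homog _ _ _ (pihomogP _ _ _)).
  rewrite -(rmorph_mmap idfun polyC) => /eqP.
  by rewrite mulf_eq0 expf_eq0 (negbTE c0) andbF /= polyC_eq0 => /eqP.
have [q' e'] := poly_cancel_dvdX s0 e.
(* Set t = [u] and take the coefficient of tau^d. *)
exists (q'.[u%:P])`_d.
have eu : u%:P ^+ m * q'.[u%:P] = ('X^m * q').[u%:P] by rewrite hornerM hornerXn.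
rewrite -coefCM polyC_exp eu -e' -horner_evalE rmorph_mmap -coef_mmapX; congr (_`_ _).
refine (congr1 _ (@eq_mmap 3 K S1 _ _ _ _ _ _ _)) => [x|i] /=; rewrite /horner_eval ?hornerC //.
rewrite /h /C /W hornerD !hornerM hornerX !hornerC polyCD !polyCM.
by rewrite mulrDr; congr (_ + _); [rewrite mulrA | rewrite mulrCA].
Qed.

End PointIdeals.

(** * Regularity: forms of large degree in the powers of the ideal *)

Section Vanishing.

Lemma poly_nonroot (K : numDomainType) (p : {poly K}) : p != 0 -> exists x, p.[x] != 0.
Proof.
move=> p0; pose s : seq K := [seq k%:R | k <- iota 0 (size p)].
have us : uniq s by rewrite map_inj_uniq ?iota_uniq //; apply: mulrIn; rewrite oner_eq0.
have [/(max_poly_roots p0)|/allPn[x _ px]] := boolP (all (root p) s); last by exists x.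
by move=> /(_ us); rewrite size_map size_iota ltnn.
Qed.

(* Kronecker substitution: [X_i -> X ^ (N ^ i)] is injective on monomials with exponents below [N]. *)
Lemma mpoly_nonroot (K : numDomainType) (f : {mpoly K[3]}) : f != 0 -> exists v, f.@[v] != 0.
Proof.
move=> f0; pose N := msize f.
pose wgt (m : 'X_{1..3}) := (m 0%R + N * (m 1%R + N * m 2%R))%N.
pose F : {poly K} := mmap polyC (fun i : 'I_3 => 'X ^+ (N ^ i)) f.
have FE : F = \sum_(m <- msupp f) f@_m *: 'X^(wgt m).
  rewrite /F /mmap; apply: eq_bigr => m _; rewrite -mul_polyC; congr (_ * _).
  rewrite /mmap1 3!big_ord_recr big_ord0 /= mul1r -!exprM -!exprD; congr ('X^_).
  rewrite /wgt -[X in m X](_ : (0 : 'I_3) = _); last exact: val_inj.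
  rewrite -[X in (_ + N ^ 1 * m X)%N](_ : (1 : 'I_3) = _); last exact: val_inj.
  rewrite -[X in (_ + N ^ 2 * m X)%N](_ : (2 : 'I_3) = _); last exact: val_inj.
  by rewrite expn0 expn1; ring.
have ltN m i : m \in msupp f -> (m i < N)%N.
  move=> /msize_mdeg_lt; apply: leq_ltn_trans.
  by rewrite mdegE (bigD1 i) //= leq_addr.
have dig a b x y : (a < N)%N -> (b < N)%N -> (a + N * x = b + N * y)%N -> a = b /\ x = y.
  move=> aN bN e; have N0 : (0 < N)%N by apply: leq_ltn_trans aN.
  have eab : a = b.
    by have := congr1 (modn^~ N) e; rewrite /= ![(N * _)%N]mulnC ![(_ + _ * N)%N]addnC !modnMDl !modn_small.
  split=> //; move: e; rewrite eab => /addnI /eqP; rewrite eqn_mul2l eqn0Ngt N0 /= => /eqP //.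
have inj m1 m2 : m1 \in msupp f -> m2 \in msupp f -> wgt m1 = wgt m2 -> m1 = m2.
  move=> s1 s2 /(dig _ _ _ _ (ltN _ _ s1) (ltN _ _ s2)) [e0].
  move=> /(dig _ _ _ _ (ltN _ _ s1) (ltN _ _ s2)) [e1 e2].
  by apply/mnmP; apply: ord3_ind.
have F0 : F != 0.
  have sm := mlead_supp f0; set m := mlead f in sm.
  apply/eqP => /(congr1 (fun p : {poly K} => p`_(wgt m))); rewrite FE coef_sum coef0.
  rewrite (bigD1_seq m) //= coefZ coefXn eqxx mulr1 big_seq_cond big1.
    by rewrite addr0 => /eqP; rewrite mcoeff_eq0 sm.
  move=> m' /andP[sm' ne]; rewrite coefZ coefXn; case: eqP => [e|]; last by rewrite mulr0.
  by rewrite (inj _ _ sm sm' e) eqxx in ne.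
have [x Fx] := poly_nonroot F0; exists (fun i : 'I_3 => x ^+ (N ^ i)).
apply: contra Fx => /eqP fx; rewrite /F -horner_evalE rmorph_mmap /= -fx.
apply/eqP; apply: eq_mmap => [c|i] /=; first by rewrite /horner_eval hornerC.
by rewrite /horner_eval hornerXn.
Qed.

(** Congruence modulo [u] passes through sums, products and powers. Taking a linear form for [u]
    yields divisibility by it. *)
Lemma mmap_congr (n : nat) (K S : comNzRingType) (phi : {rmorphism K -> S}) (h k : 'I_n -> S)
    (u : S) (f : {mpoly K[n]}) : (forall i, exists q, h i = k i + u * q) ->
  exists q, mmap phi h f = mmap phi k f + u * q.
Proof.
move=> hk; elim/mpolyind: f => [|c m f _ _ [q e]].
  by exists 0; rewrite !mmap0 mulr0 addr0.
suff [q' e'] : exists q', mmap1 h m = mmap1 k m + u * q'.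
  by exists (phi c * q' + q); rewrite !mmapD !mmapZ !mmapX e e'; ring.
rewrite /mmap1; elim/big_rec2: _ => [|i y x _ [q' ->]]; first by exists 0; rewrite mulr0 addr0.
suff [p ->] : exists p, h i ^+ m i = k i ^+ m i + u * p.
  by exists (p * y + k i ^+ m i * q' + u * p * q'); ring.
have [p ep] := hk i; elim: (m i) => [|l [p' IHl]]; first by exists 0; rewrite mulr0 addr0.
exists (p * k i ^+ l + k i * p' + u * p * p'); rewrite !exprS IHl ep; ring.
Qed.

End Vanishing.

(** * Dual linear forms and the differentials of the cubics *)

Section Plane.
Variable K : numDomainType.
Implicit Types (A : {set 'I_3}) (P : {mpoly K[3]}).

(** Equation of the image of the differential of the cubics at [pt A]: differentiating the linear
    syzygy there shows that the image lies in this plane, and [dcubic_onto] gives the converse. *)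
Definition dual_form A : {mpoly K[3]} := \sum_i (pt K A i) *: 'X_i.

(** Subtracting [L] from the coordinate [i0], whose coefficient in [L] is 1, projects onto the plane
    [L = 0]. So [P] composed with this projection [s] vanishes everywhere, hence is zero, and it is
    congruent to [P] modulo [L]. *)
Lemma dual_form_dvd A P : A != set0 ->
  (forall v : 'I_3 -> K, \sum_i pt K A i * v i = 0 -> P.@[v] = 0) ->
  exists q, P = dual_form A * q.
Proof.
move=> /set0Pn [i0 i0A] P0; set L := dual_form A.
pose s i : {mpoly K[3]} := 'X_i - (if i == i0 then L else 0).
have [|q e] := @mmap_congr 3 _ _ (@mpolyC 3 K) (fun i => 'X_i) s L P.
  by move=> i; rewrite /s; exists (if i == i0 then 1 else 0); case: eqP => _; ring.
have PE : mmap (@mpolyC 3 K) (fun i => 'X_i) P = P.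
  by rewrite {2}[P]mpolyE /mmap; apply: eq_bigr => m _; rewrite mmap1_id mul_mpolyC.
exists q; rewrite -{1}PE e; suff -> : mmap (@mpolyC 3 K) s P = 0 by rewrite add0r.
apply/eqP/negbNE/negP => /mpoly_nonroot [v] /eqP; apply.
rewrite (rmorph_mmap _ (meval v)) -[RHS](P0 (fun i => (s i).@[v])).
  by apply: eq_mmap => // c; rewrite /= mevalC.
have Lv : L.@[v] = \sum_i pt K A i * v i.
  by rewrite raddf_sum; apply: eq_bigr => i _; rewrite /= mevalZ mevalXU.
rewrite (eq_bigr (fun i => pt K A i * v i - (if i == i0 then L.@[v] else 0))).
  by rewrite sumrB -Lv -big_mkcond big_pred1_eq subrr.
move=> i _; rewrite /s mevalB mevalXU mulrBr; congr (_ - _).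
by case: eqP => [->|_]; rewrite ?meval0 ?mulr0 // /pt i0A mul1r.
Qed.

Lemma dual_form_homog A : dual_form A \is 1.-homog.
Proof. by apply: rpred_sum => i _; apply: rpredZ; rewrite dhomogX /= mdeg1. Qed.

Lemma dual_form_dvd_homog A k P : A != set0 -> P \is k.+1.-homog ->
  (forall v : 'I_3 -> K, \sum_i pt K A i * v i = 0 -> P.@[v] = 0) ->
  exists2 q, q \is k.-homog & P = dual_form A * q.
Proof.
move=> A0 homP /(dual_form_dvd A0) [q e]; exists (pihomog mdeg k q); first exact: pihomogP.
by rewrite -(pihomogM _ _ (dual_form_homog A)) -e add1n pihomog_dE.
Qed.

(* The differential of the [i]-th cubic at [pt A], applied to [w]. *)
Definition dcubic A (w : 'I_3 -> K) (i : 'I_3) : K :=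
  let a := pt K A (i + 1) in let b := pt K A (i + 2) in
  let a' := w (i + 1) in let b' := w (i + 2) in
  (a' * b + a * b') * (a - b) + a * b * (a' - b').

(** The points are reduced, so the differential has rank 2 at each of them; a preimage is given
    explicitly in each of the seven cases. *)
Lemma dcubic_onto A (v : 'I_3 -> K) : A != set0 -> \sum_i pt K A i * v i = 0 ->
  exists w, dcubic A w =1 v.
Proof.
move=> A0; rewrite sum_ord3 /pt.
pose W a b c := fun i : 'I_3 => nth 0 [:: a; b; c] i : K.
(* A coordinate equation that fails identically holds after subtracting or adding the relation [e]
   once. *)
have subz x y z : z = 0 -> x = y - z -> x = y :> K by move=> ->; rewrite subr0.
have addz x y z : z = 0 -> x = y + z -> x = y :> K by move=> ->; rewrite addr0.
have ext w : dcubic A w 0 = v 0 /\ dcubic A w 1 = v 1 /\ dcubic A w 2 = v 2 ->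
    exists w, dcubic A w =1 v.
  by case=> [e0 [e1 e2]]; exists w; apply: ord3_ind.
rewrite /dcubic !ord3_add /pt in ext.
have [a0|a0] := boolP (0 \in A); have [a1|a1] := boolP (1 \in A);
  have [a2|a2] := boolP (2 \in A); rewrite ?a0 ?a1 ?a2 ?(negbTE a0) ?(negbTE a1) ?(negbTE a2)
    /= in ext *; rewrite ?mul1r ?mul0r ?add0r ?addr0 => e.
- apply: (ext (W 0 (- v 2) (v 1))); rewrite /W /=; do !split; first [ring | apply: (subz _ _ _ e); ring | apply: (addz _ _ _ e); ring].
- apply: (ext (W (v 2) 0 (v 0))); rewrite /W /=; do !split; first [ring | apply: (subz _ _ _ e); ring | apply: (addz _ _ _ e); ring].
- apply: (ext (W 0 (v 2) (v 1))); rewrite /W /=; do !split; first [ring | apply: (subz _ _ _ e); ring | apply: (addz _ _ _ e); ring].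
- apply: (ext (W 0 (v 2) (- v 1))); rewrite /W /=; do !split; first [ring | apply: (subz _ _ _ e); ring | apply: (addz _ _ _ e); ring].
- apply: (ext (W (v 1) (v 0) 0)); rewrite /W /=; do !split; first [ring | apply: (subz _ _ _ e); ring | apply: (addz _ _ _ e); ring].
- apply: (ext (W (- v 2) 0 (v 0))); rewrite /W /=; do !split; first [ring | apply: (subz _ _ _ e); ring | apply: (addz _ _ _ e); ring].
- apply: (ext (W (v 1) (- v 0) 0)); rewrite /W /=; do !split; first [ring | apply: (subz _ _ _ e); ring | apply: (addz _ _ _ e); ring].
- by case/negP: A0; apply/eqP/setP; apply: ord3_ind; rewrite inE; apply: negbTE.
Qed.

End Plane.

(** * Elements of the powers as forms in the cubics *)

Section PowersAsForms.
Variable K : comNzRingType.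
Notation R := {mpoly K[3]}.
Implicit Types (f g : R) (C : {mpoly R[3]}).

Lemma cubic_homog i : cubic K i \is 3.-homog.
Proof.
have homX k : ('X_k : R) \is 1.-homog by rewrite dhomogX /= mdeg1.
rewrite /cubic -[3%N]/(1 + 1 + 1)%N.
by do !apply: dhomogM => //; rewrite rpredB.
Qed.

Lemma seven_ideal_form f : seven_ideal f ->
  exists2 C : {mpoly R[3]}, C \is 1.-homog & f = C.@[cubic K].
Proof.
move=> /seven_idealE; move: f; apply: ideal_gen_min => [|f [i ->]]; last first.
  by exists 'X_i; [rewrite dhomogX /= mdeg1 | rewrite mevalXU].
split; first by exists 0; [exact: dhomog0 | rewrite meval0].
split=> [a b [Ca hA ->] [Cb hB ->]|r a [C hC ->]].
  by exists (Ca + Cb); [exact: rpredD | rewrite mevalD].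
by exists (r *: C); [exact: rpredZ | rewrite mevalZ].
Qed.

Lemma ideal_pow_form k f : ideal_pow seven_ideal k f ->
  exists2 C : {mpoly R[3]}, C \is k.-homog & f = C.@[cubic K].
Proof.
move: f; apply: ideal_gen_min => [|f [g [Jg ->]]].
  split; first by exists 0; [exact: dhomog0 | rewrite meval0].
  split=> [a b [Ca hA ->] [Cb hB ->]|r a [C hC ->]].
    by exists (Ca + Cb); [exact: rpredD | rewrite mevalD].
  by exists (r *: C); [exact: rpredZ | rewrite mevalZ].
elim: k g Jg => [|k IHk] g Jg; first by exists 1; [exact: dhomog1 | rewrite big_ord0 meval1].
have [|C hC e] := IHk (fun i => g (lift ord0 i)); first by move=> i; apply: Jg.
have [C1 h1 e1] := seven_ideal_form (Jg ord0).
exists (C1 * C); first by rewrite -(add1n k) dhomogM.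
by rewrite big_ord_recl e1 e mevalM.
Qed.

(** The coefficients supply one more factor from the ideal. *)
Lemma form_ideal_pow k C : C \is k.-homog -> (forall m, seven_ideal C@_m) ->
  ideal_pow seven_ideal k.+1 C.@[cubic K].
Proof.
move=> /dhomogP hC JC; rewrite mevalE.
apply: ideal_sum_seq => [|m /hC <-]; first exact: ideal_pow_ideal.
apply: ideal_powS => //; rewrite /= mdegE.
apply: (big_rec2 (fun k a => ideal_pow seven_ideal k a)) => [|i a b _ Hb]; first exact: ideal_pow0.
apply: ideal_pow_mul => //; rewrite -[X in ideal_pow _ X]mul1n.
by apply: ideal_pow_exp; apply: ideal_pow1; apply: seven_ideal_cubic.
Qed.

(** A monomial of degree [k] in the cubics has degree [3 * k], so taking the component of degree [d]
    amounts to replacing each coefficient by its component of degree [d - 3 * k]. *)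
Lemma form_homog_coeffs d k f : (3 * k <= d)%N -> f \is d.-homog ->
  ideal_pow seven_ideal k f ->
  exists C : {mpoly R[3]}, [/\ C \is k.-homog, (forall m, C@_m \is (d - 3 * k).-homog)
    & f = C.@[cubic K]].
Proof.
move=> le_kd homf /ideal_pow_form [C homC eC].
exists (\sum_(m <- msupp C) pihomog mdeg (d - 3 * k) C@_m *: 'X_[m]); split.
- rewrite big_seq; apply: rpred_sum => m sm; apply: rpredZ.
  by rewrite dhomogX /= (dhomogP _ _ _ homC).
- move=> m'; rewrite raddf_sum; apply: rpred_sum => m _ /=.
  by rewrite mcoeffZ mcoeffX mulr_natr; apply: rpredMn; apply: pihomogP.
rewrite -(pihomog_dE homf) eC mevalE !raddf_sum !big_seq; apply: eq_bigr => m sm /=.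
rewrite mevalZ mevalX [in LHS]mulrC [in RHS]mulrC -{1}(subnKC le_kd).
apply: pihomogM; rewrite -(dhomogP _ _ _ homC _ sm) /= mdegE big_distrr /=.
apply: (big_rec2 (fun d (a : R) => a \is d.-homog)) => [|i a b _ hb]; first exact: dhomog1.
by apply: dhomogM => //; apply: dhomogMn; apply: cubic_homog.
Qed.

End PowersAsForms.

(** * Passing from one power of the ideal to the next *)

Section Regularity.
Variable K : numFieldType.
Notation R := {mpoly K[3]}.
Implicit Types (f g : R) (C : {mpoly R[3]}) (A : {set 'I_3}).

Definition at_pt A : {mpoly R[3]} -> {mpoly K[3]} := map_mpoly (meval (pt K A)).

Lemma cubic_near_pt A (w : 'I_3 -> K) i : exists2 h : {poly K},
  mmap polyC (fun j => 1 * (pt K A j)%:P + 'X * (w j)%:P) (cubic K i) = 'X * h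
  & h.[0] = dcubic A w i.
Proof.
rewrite /cubic !rmorphM rmorphB /= !mmapX !mmap1U /dcubic.
set a := pt K A _; set b := pt K A _; set a' := w _; set b' := w _.
have ab0 : a * b * (a - b) = 0.
  rewrite /a /b /pt; do 2!case: (_ \in A); rewrite /=; ring.
(* Taylor expansion of the cubic at the point, divided by ['X]; its constant term vanishes by
   [ab0]. *)
exists (((a' * b + a * b') * (a - b) + a * b * (a' - b'))%:P
  + 'X * ((a' * b' * (a - b) + (a' * b + a * b') * (a' - b'))%:P
  + 'X * (a' * b' * (a' - b'))%:P)); last first.
  by rewrite !(hornerE, mul0r, addr0).
rewrite !mul1r; transitivity ((a * b * (a - b))%:P + 'X *
  (((a' * b + a * b') * (a - b) + a * b * (a' - b'))%:P
  + 'X * ((a' * b' * (a - b) + (a' * b + a * b') * (a' - b'))%:P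
  + 'X * (a' * b' * (a' - b'))%:P))); last by rewrite ab0 add0r.
by rewrite !(polyCD, polyCM, polyCN, polyCB); ring.
Qed.

(* Comparing the coefficients of [t ^ k] in [f (pt A + t w)]. *)
Lemma at_pt_dcubic A k C (w : 'I_3 -> K) : C \is k.-homog ->
  vanish_order (pt K A) k.+1 C.@[cubic K] -> (at_pt A C).@[dcubic A w] = 0.
Proof.
move=> homC /(_ 1 'X (fun i => (w i)%:P) (oner_neq0 _)) [q].
pose phi : {rmorphism R -> {poly K}} :=
  mmap polyC (fun i => 1 * (pt K A i)%:P + 'X * (w i)%:P).
have /fin_all_exists2 [h eh h0] := cubic_near_pt A w.
rewrite -[LHS]/(phi _) {1}/meval rmorph_mmap (@eq_mmap _ _ _ _ phi _ (fun i => 'X * h i)) //.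
rewrite (mmap_homog _ _ _ homC) exprSr -mulrA.
(* After cancelling ['X ^+ k] one factor ['X] remains on the right, so the left side vanishes at
   0. *)
move/(mulfI (expf_neq0 _ (negbT (polyX_eq0 _)))) => eG.
rewrite /meval /at_pt (rmorph_mmap _ (meval (dcubic A w))).
have := congr1 (horner_eval 0) eG; rewrite rmorphM /= [horner_eval 0 'X]hornerX mul0r.
rewrite rmorph_mmap => e0; rewrite -[RHS]e0; apply: eq_mmap => [g|i] /=.
  rewrite mevalC /phi rmorph_mmap; apply: eq_mmap => [c|i] /=.
    by rewrite /horner_eval hornerC.
  by rewrite /horner_eval !hornerE ?mul0r ?addr0 ?mul1r.
by rewrite mevalXU /horner_eval h0.
Qed.

Lemma at_pt_dvd A k C : A != set0 -> C \is k.+1.-homog ->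
  vanish_order (pt K A) k.+2 C.@[cubic K] ->
  exists2 q, q \is k.-homog & at_pt A C = dual_form K A * q.
Proof.
move=> A0 homC fA; apply: dual_form_dvd_homog => // [|v /(dcubic_onto A0) [w ew]].
  apply/dhomogP => m; rewrite mcoeff_msupp mcoeff_map_mpoly /= => Cm.
  apply: (dhomogP _ _ _ homC); rewrite mcoeff_msupp.
  by apply: contra Cm => /eqP ->; rewrite meval0.
by rewrite -(at_pt_dcubic w homC fA); apply: meval_eq => i; rewrite ew.
Qed.

Definition linear_syzygy : {mpoly R[3]} := \sum_i ('X_i : R)%:MP * 'X_i.

Lemma linear_syzygy_cubic : linear_syzygy.@[cubic K] = 0.
Proof.
rewrite /linear_syzygy sum_ord3 !mevalD !mevalM !mevalC !mevalXU.
by rewrite /cubic !ord3_add; ring.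
Qed.

Lemma ideal_powS_regular d k f : (3 * k.+1 < d)%N -> f \is d.-homog ->
  (forall A, A != set0 -> vanish_order (pt K A) k.+1 f) ->
  ideal_pow seven_ideal k f -> ideal_pow seven_ideal k.+1 f.
Proof.
move=> lt_kd homf fA; case: k lt_kd fA => [|k] lt_kd fA Jf.
  (* For [k = 0] there is no linear form to divide by; the constant arc shows that order 1 means
     vanishing at the points. *)
  apply: ideal_pow1; apply: (homog_vanish_seven_ideal homf) => A A0.
  have [q] := fA A A0 1 'X (fun=> 0) (oner_neq0 _).
  move=> /(congr1 (horner_eval 0)); rewrite rmorph_mmap expr1 rmorphM /=.
  rewrite [horner_eval 0 'X]hornerX mul0r => e.
  rewrite -[RHS]e; apply: eq_mmap => [c|i] /=; rewrite /horner_eval ?hornerC //.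
  by rewrite mul1r mulr0 addr0 hornerC.
have [|C [homC homCm eC]] := form_homog_coeffs _ homf Jf; first by lia.
have [q hq] : exists q : {set 'I_3} -> {mpoly K[3]}, forall A, A != set0 ->
    q A \is k.-homog /\ at_pt A C = dual_form K A * q A.
  apply: (fin_all_exists (P := fun A q => A != set0 -> q \is k.-homog /\ at_pt A C = dual_form K A * q)).
  move=> A; have [->|A0] := eqVneq A set0; first by exists 0.
  rewrite eC in fA; have [q q1 q2] := at_pt_dvd A0 homC (fA A A0).
  by exists q.
(* The coefficients have degree [e], and the syzygy contributes degree 1, so separators of degree
   [e.-1] are needed; they exist from degree 3 on. *)
pose e := (d - 3 * k.+1)%N; have e4 : (4 <= e)%N by rewrite /e; lia.
pose emb : {mpoly K[3]} -> {mpoly R[3]} := map_mpoly (@mpolyC 3 K).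
(* Lagrange interpolation: [Q] specialises to [q A] at each [pt A]. *)
pose Q : {mpoly R[3]} := \sum_(A | A != set0) (separator K e.-1 A)%:MP * emb (q A).
pose C' := C - linear_syzygy * Q.
have eC' : f = C'.@[cubic K] by rewrite mevalB mevalM linear_syzygy_cubic mul0r subr0.
have emb_homog l p : p \is l.-homog -> emb p \is l.-homog.
  move=> /dhomogP hp; apply/dhomogP => m; rewrite mcoeff_msupp mcoeff_map_mpoly /= => pm.
  by apply: hp; rewrite mcoeff_msupp; apply: contra pm => /eqP ->; rewrite mpolyC0.
have homC' : C' \is k.+1.-homog.
  apply: rpredB => //; rewrite -(add1n k); apply: dhomogM.
    apply: rpred_sum => i _; rewrite mul_mpolyC; apply: rpredZ.
    by rewrite dhomogX /= mdeg1.
  apply: rpred_sum => A A0; rewrite mul_mpolyC; apply: rpredZ; apply: emb_homog.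
  by case: (hq A A0).
have homC'm m : C'@_m \is e.-homog.
  rewrite mcoeffB; apply: rpredB; first exact: homCm.
  rewrite /linear_syzygy /Q mulr_suml raddf_sum; apply: rpred_sum => i _ /=.
  rewrite mulr_sumr raddf_sum; apply: rpred_sum => A A0 /=.
  have -> : ('X_i : R)%:MP * 'X_i * ((separator K e.-1 A)%:MP * emb (q A))
      = ('X_i * separator K e.-1 A) *: emb ('X_i * q A).
    rewrite -mul_mpolyC mpolyCM /emb rmorphM /= map_mpolyX; ring.
  rewrite mcoeffZ mcoeff_map_mpoly /= mulrC mul_mpolyC; apply: rpredZ.
  suff : 'X_i * separator K e.-1 A \is (1 + e.-1).-homog.
    by rewrite add1n prednK //; apply: leq_trans e4.
  apply: dhomogM; first by rewrite dhomogX /= mdeg1.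
  by apply: separator_homog; lia.
have C'_pt A : A != set0 -> at_pt A C' = 0.
  move=> A0; have [_ eA] := hq A A0.
  rewrite /at_pt rmorphB rmorphM /= -!/(at_pt A _) eA.
  have -> : at_pt A linear_syzygy = dual_form K A.
    rewrite /at_pt rmorph_sum; apply: eq_bigr => i _ /=.
    by rewrite rmorphM /= map_mpolyC map_mpolyX /= mevalXU mul_mpolyC.
  suff -> : at_pt A Q = q A by rewrite subrr.
  rewrite /at_pt rmorph_sum (bigD1 A) //= big1 ?addr0.
    rewrite rmorphM /= map_mpolyC /= separator_pt // eqxx mpolyC1 mul1r.
    by apply/mpolyP => m; rewrite !mcoeff_map_mpoly /= mevalC.
  move=> B /andP[B0 neBA].
  by rewrite rmorphM /= map_mpolyC /= separator_pt // (negbTE neBA) mpolyC0 mul0r.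
rewrite eC'; apply: form_ideal_pow => // m.
apply: (homog_vanish_seven_ideal (homC'm m)) => A /C'_pt /(congr1 (mcoeff m)).
by rewrite mcoeff_map_mpoly mcoeff0.
Qed.

Lemma vanish_order_ideal_pow d r f : (3 * r < d)%N -> f \is d.-homog ->
  (forall A, A != set0 -> vanish_order (pt K A) r f) -> ideal_pow seven_ideal r f.
Proof.
move=> + homf; elim: r => [|r IHr] lt_rd fA; first exact: ideal_pow0.
apply: (ideal_powS_regular lt_rd homf fA); apply: IHr => [|A A0]; first by lia.
by apply: vanish_order_leq (fA A A0).
Qed.

End Regularity.

(** * Degree bound from a pencil of rational quartics *)

Section Pencil.

(* In the coordinates adapted to the three points with two nonzero entries, the curve
   below is the image under the standard Cremona map of the conic [X^2 - Z^2 = l (Y^2 - Z^2)]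
   through [(+-1, +-1, 1)]: a rational quartic with double points there, passing through
   the other four points. As [l] varies these quartics fill the plane. *)
Section Quadrics.
Variable S : comNzRingType.
(** Parametrisation of the conic by projection from (-1, -1, 1): [s : t] is the ratio
    [(X + Z) : (Y + Z)]. *)
Definition qX (l s t : S) := s ^+ 2 - 2 * (l * (s * t)) + l * t ^+ 2.
Definition qY (l s t : S) := - s ^+ 2 + 2 * (s * t) - l * t ^+ 2.
Definition qZ (l s t : S) := s ^+ 2 - l * t ^+ 2.

Definition quartic (l s t : S) (i : 'I_3) : S :=
  let X := qX l s t in let Y := qY l s t in let Z := qZ l s t in
  nth 0 [:: X * (Y + Z); Y * (X + Z); Z * (X + Y)] i.

(** Equations of the parameters at which the quartic meets the seven points: four linear ones for
    the simple points, three quadratic ones for the two branches at each double point. *)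
Definition tangency (l s t : S) : seq S :=
  [:: s; t; s - t; s - l * t; qX l s t; qY l s t; qZ l s t].
End Quadrics.

Definition bset (a b c : bool) : {set 'I_3} := [set i : 'I_3 | nth false [:: a; b; c] i].

Lemma size_quadratic (K : idomainType) (a b c : K) : a != 0 ->
  size ((a%:P * 'X + b%:P) * 'X + c%:P) = 3%N.
Proof.
move=> a0; have s2 : size (a%:P * 'X + b%:P) = 2%N.
  by rewrite size_MXaddC polyC_eq0 (negbTE a0) /= size_polyC a0.
by rewrite size_MXaddC -size_poly_eq0 s2.
Qed.

Lemma size_linear (K : idomainType) (a b : K) : a != 0 -> size (a%:P * 'X + b%:P) = 2%N.
Proof. by move=> a0; rewrite size_MXaddC polyC_eq0 (negbTE a0) /= size_polyC a0. Qed.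

Lemma size_mmap_homog (n : nat) (K : comNzRingType) (h : 'I_n -> {poly K}) e d (f : {mpoly K[n]}) :
  (forall i, (size (h i) <= e.+1)%N) -> f \is d.-homog ->
  (size (mmap polyC h f) <= (e * d).+1)%N.
Proof.
move=> hs homf.
have szM (p q : {poly K}) a b : (size p <= a.+1)%N -> (size q <= b.+1)%N ->
    (size (p * q)%R <= (a + b).+1)%N.
  by move=> ha hb; apply: leq_trans (size_polyMleq _ _) _; lia.
rewrite /mmap big_seq; elim/big_ind: _ => [|p q hp hq|m sm].
- by rewrite size_poly0.
- by apply: leq_trans (size_polyD _ _) _; rewrite geq_max hp.
rewrite -[(e * d)%N]add0n; apply: (szM); first by rewrite size_polyC; case: eqP.
rewrite /mmap1 -(dhomogP _ _ _ homf _ sm) /= mdegE.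
apply: (big_rec2 (fun (k : nat) (p : {poly K}) => (size p <= (e * k).+1)%N)).
  by rewrite size_poly1.
move=> i k p _ hp; rewrite mulnDr; apply: (szM) => //.
apply: leq_trans (size_poly_exp_leq _ _) _; rewrite ltnS leq_mul2r.
by rewrite -subn1 leq_subLR add1n hs orbT.
Qed.

Lemma prod_exp_dvdp (K : fieldType) (ps : seq {poly K}) m h :
  pairwise (@coprimep K) ps -> (forall u, u \in ps -> u ^+ m %| h) ->
  (\prod_(u <- ps) u) ^+ m %| h.
Proof.
elim: ps => [|u ps IHps] /=; first by rewrite big_nil expr1n dvd1p.
move=> /andP[/allP cu /IHps IH] dv; rewrite big_cons exprMn Gauss_dvdp.
  rewrite dv ?mem_head //=; apply: IH => v vps.
  by apply: dv; rewrite in_cons vps orbT.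
apply: coprimep_expl; apply: coprimep_expr; rewrite big_seq.
by elim/big_ind: _ => // [|p q hp hq]; rewrite ?coprimep1 // coprimepMr hp.
Qed.

Variable K : numClosedFieldType.
Implicit Types (f : {mpoly K[3]}) (l : K).

(** The conic degenerates for [l] equal to 0 or 1. The normalisation [s + t = 1] loses one parameter
    at infinity; the last three conditions, together with [1 - l != 0], keep the degrees of the
    tangency equations from dropping there. *)
Definition generic l := [&& l != 0, 1 - l != 0, 1 + l != 0, 1 + 3 * l != 0 & 3 + l != 0].

Notation tang l := (tangency l%:P 'X (1 - 'X)).

Lemma horner_qX l x : (qX l%:P 'X (1 - 'X)).[x] = qX l x (1 - x).
Proof. by rewrite /qX !hornerE; ring. Qed.
Lemma horner_qY l x : (qY l%:P 'X (1 - 'X)).[x] = qY l x (1 - x).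
Proof. by rewrite /qY !hornerE; ring. Qed.
Lemma horner_qZ l x : (qZ l%:P 'X (1 - 'X)).[x] = qZ l x (1 - x).
Proof. by rewrite /qZ !hornerE; ring. Qed.

(** For a linear factor, the others are evaluated at its root. The sum of two of the quadrics is a
    product of linear factors, so a common root would be a root of one of these, where the quadrics
    do not vanish. *)
Lemma tangency_coprime l : generic l -> pairwise (@coprimep K) (tang l).
Proof.
case/and5P => l0 l1 l1' _ _.
have two0 : (2 : K) != 0 by rewrite pnatr_eq0.
have lin_at (p q : {poly K}) x0 : (forall x, p.[x] = 0 -> x = x0) -> q.[x0] != 0 -> coprimep p q.
  by move=> px q0; apply: Pdiv.ClosedField.root_coprimep => x /rootP /px ->.
have r0 (x : K) : ('X : {poly K}).[x] = 0 -> x = 0 by rewrite hornerX.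
have r1 (x : K) : (1 - 'X : {poly K}).[x] = 0 -> x = 1.
  by rewrite !hornerE => /eqP; rewrite subr_eq0 => /eqP.
have r2 (x : K) : ('X - (1 - 'X) : {poly K}).[x] = 0 -> x = 2^-1.
  by rewrite !hornerE => e; apply: (mulfI two0); rewrite divff //; apply/eqP; rewrite -subr_eq0 -e; apply/eqP; ring.
have r3 (x : K) : ('X - l%:P * (1 - 'X)).[x] = 0 -> x = l / (1 + l).
  rewrite !hornerE => e; apply: (mulIf l1'); rewrite divfK //; apply/eqP; rewrite -subr_eq0 -e; apply/eqP; ring.
have XZ x : qX l x (1 - x) + qZ l x (1 - x) = 2 * x * (x - l * (1 - x)) by rewrite /qX /qZ; ring.
have YZ x : qY l x (1 - x) + qZ l x (1 - x) = 2 * (1 - x) * (x - l * (1 - x)).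
  by rewrite /qY /qZ; ring.
have XY x : qX l x (1 - x) + qY l x (1 - x) = 2 * x * (1 - x) * (1 - l) by rewrite /qX /qY; ring.
(* Values of the quadrics at the roots of the four linear factors. *)
have v0 : [/\ qX l 0 (1 - 0) = l, qY l 0 (1 - 0) = - l & qZ l 0 (1 - 0) = - l].
  by rewrite /qX /qY /qZ; split; ring.
have v1 : [/\ qX l 1 (1 - 1) = 1, qY l 1 (1 - 1) = -1 & qZ l 1 (1 - 1) = 1].
  by rewrite /qX /qY /qZ; split; ring.
have v2 : [/\ qX l 2^-1 (1 - 2^-1) = (1 - l) / 4, qY l 2^-1 (1 - 2^-1) = (1 - l) / 4
    & qZ l 2^-1 (1 - 2^-1) = (1 - l) / 4].
  by rewrite /qX /qY /qZ; split; field.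
have v3 : [/\ qX l (l / (1 + l)) (1 - l / (1 + l)) = l * (1 - l) / (1 + l) ^+ 2,
    qY l (l / (1 + l)) (1 - l / (1 + l)) = l * (1 - l) / (1 + l) ^+ 2
    & qZ l (l / (1 + l)) (1 - l / (1 + l)) = - (l * (1 - l)) / (1 + l) ^+ 2].
  by rewrite /qX /qY /qZ; split; field.
case: v0 => X0 Y0 Z0; case: v1 => X1 Y1 Z1; case: v2 => X2 Y2 Z2; case: v3 => X3 Y3 Z3.
have four0 : (4 : K) != 0 by rewrite pnatr_eq0.
have n2 : (1 - l) / 4 != 0 by rewrite mulf_neq0 // invr_neq0.
have n3 : l * (1 - l) / (1 + l) ^+ 2 != 0 by rewrite !mulf_neq0 // invr_neq0 // expf_neq0.
have n3' : - (l * (1 - l)) / (1 + l) ^+ 2 != 0 by rewrite mulNr oppr_eq0.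
rewrite /tangency /= !andbT; do !(apply/andP; split).
- by apply: (lin_at _ _ _ r0); rewrite !hornerE ?subr0 oner_neq0.
- by apply: (lin_at _ _ _ r0); rewrite !hornerE ?subr0 ?sub0r oppr_eq0 oner_neq0.
- by apply: (lin_at _ _ _ r0); rewrite !hornerE ?subr0 ?mulr1 ?sub0r oppr_eq0.
- by apply: (lin_at _ _ _ r0); rewrite horner_qX X0.
- by apply: (lin_at _ _ _ r0); rewrite horner_qY Y0 oppr_eq0.
- by apply: (lin_at _ _ _ r0); rewrite horner_qZ Z0 oppr_eq0.
- by apply: (lin_at _ _ _ r1); rewrite !hornerE subrr ?subr0 oner_neq0.
- by apply: (lin_at _ _ _ r1); rewrite !hornerE subrr ?mulr0 ?subr0 oner_neq0.
- by apply: (lin_at _ _ _ r1); rewrite horner_qX X1 oner_neq0.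
- by apply: (lin_at _ _ _ r1); rewrite horner_qY Y1 oppr_eq0 oner_neq0.
- by apply: (lin_at _ _ _ r1); rewrite horner_qZ Z1 oner_neq0.
- apply: (lin_at _ _ _ r2); rewrite !hornerE.
  rewrite (_ : _ - _ = (1 - l) / 2); last by field.
  by rewrite mulf_neq0 // invr_neq0.
- by apply: (lin_at _ _ _ r2); rewrite horner_qX X2.
- by apply: (lin_at _ _ _ r2); rewrite horner_qY Y2.
- by apply: (lin_at _ _ _ r2); rewrite horner_qZ Z2.
- by apply: (lin_at _ _ _ r3); rewrite horner_qX X3.
- by apply: (lin_at _ _ _ r3); rewrite horner_qY Y3.
- by apply: (lin_at _ _ _ r3); rewrite horner_qZ Z3.
- apply: Pdiv.ClosedField.root_coprimep => x /rootP; rewrite horner_qX horner_qY => ex.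
  apply/eqP => ey; have := XY x; rewrite ex ey addr0 => /esym/eqP.
  rewrite !mulf_eq0 (negbTE two0) (negbTE l1) orbF /= => /orP[/eqP x0|].
    by move: ex; rewrite x0 X0 => /eqP; rewrite (negbTE l0).
  by rewrite subr_eq0 => /eqP x0; move: ex; rewrite -x0 X1 => /eqP; rewrite oner_eq0.
- apply: Pdiv.ClosedField.root_coprimep => x /rootP; rewrite horner_qX horner_qZ => ex.
  apply/eqP => ey; have := XZ x; rewrite ex ey addr0 => /esym/eqP.
  rewrite !mulf_eq0 (negbTE two0) /= => /orP[/eqP x0|/eqP e].
    by move: ex; rewrite x0 X0 => /eqP; rewrite (negbTE l0).
  have x0 : x = l / (1 + l) by apply: r3; rewrite !hornerE.
  by move: ex; rewrite x0 X3 => /eqP; rewrite (negbTE n3).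
- apply: Pdiv.ClosedField.root_coprimep => x /rootP; rewrite horner_qY horner_qZ => ex.
  apply/eqP => ey; have := YZ x; rewrite ex ey addr0 => /esym/eqP.
  rewrite !mulf_eq0 (negbTE two0) /= => /orP[|/eqP e].
    rewrite subr_eq0 => /eqP x0; move: ex; rewrite -x0 Y1 => /eqP.
    by rewrite oppr_eq0 oner_eq0.
  have x0 : x = l / (1 + l) by apply: r3; rewrite !hornerE.
  by move: ex; rewrite x0 Y3 => /eqP; rewrite (negbTE n3).
Qed.

End Pencil.

(** * Counting zeros on the quartics *)

Section DegreeBound.
Variable K : numClosedFieldType.
Implicit Types (f : {mpoly K[3]}) (l : K).

Notation tang l := (tangency l%:P 'X (1 - 'X)).
Notation curve l := (quartic l%:P 'X (1 - 'X)).

Lemma tangency_size l : generic l -> [seq size (u : {poly K}) | u <- tang l] = [:: 2; 2; 2; 2; 3; 3; 3]%N.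
Proof.
case/and5P => l0 l1 l1' l3 l3' /=.
have two0 : (2 : K) != 0 by rewrite pnatr_eq0.
rewrite size_polyX.
have -> : 1 - 'X = (-1)%:P * 'X + 1%:P :> {poly K} by rewrite polyCN; ring.
rewrite size_linear ?oppr_eq0 ?oner_eq0 //.
have -> : 'X - ((-1)%:P * 'X + 1%:P) = 2%:P * 'X + (-1)%:P :> {poly K}.
  by rewrite polyCN (polyCMn 1 2); ring.
rewrite size_linear //.
have -> : 'X - l%:P * ((-1)%:P * 'X + 1%:P) = (1 + l)%:P * 'X + (- l)%:P.
  by rewrite !(polyCN, polyCD); ring.
rewrite size_linear //.
have -> : qX l%:P 'X ((-1)%:P * 'X + 1%:P)
    = ((1 + 3 * l)%:P * 'X + (- (4 * l))%:P) * 'X + l%:P.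
  by rewrite /qX !(polyCN, polyCD, polyCM, polyCMn); ring.
have -> : qY l%:P 'X ((-1)%:P * 'X + 1%:P)
    = ((- (3 + l))%:P * 'X + (2 * (1 + l))%:P) * 'X + (- l)%:P.
  by rewrite /qY !(polyCN, polyCD, polyCM, polyCMn); ring.
have -> : qZ l%:P 'X ((-1)%:P * 'X + 1%:P)
    = ((1 - l)%:P * 'X + (2 * l)%:P) * 'X + (- l)%:P.
  by rewrite /qZ !(polyCN, polyCB, polyCM, polyCMn); ring.
by rewrite !size_quadratic ?oppr_eq0.
Qed.

Lemma tangency_neq0 l u : generic l -> u \in tang l -> u != 0.
Proof.
move=> /tangency_size sz uin; rewrite -size_poly_gt0.
have : size u \in [seq size (u : {poly K}) | u <- tang l] by apply: (map_f (fun u : {poly K} => size u)).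
by rewrite sz !inE; do !(case/predU1P => [-> //|]); move=> /eqP ->.
Qed.

Lemma bset_neq0 a b c : [|| a, b | c] -> bset a b c != set0.
Proof.
by case/or3P => h; apply/set0Pn; [exists 0 | exists 1 | exists 2]; rewrite inE.
Qed.

(** For each factor [u] the curve is written as a nonzero multiple of one of the seven points plus a
    multiple of [u], the shape tested by [vanish_order]. *)
Lemma tangency_dvd l m f : generic l ->
  (forall A, A != set0 -> vanish_order (pt K A) m f) ->
  forall u, u \in tang l -> u ^+ m %| mmap polyC (curve l) f.
Proof.
move=> gl fA; have nz := tangency_neq0 gl.
have two0 : (2 : {poly K}) != 0 by rewrite -polyC1 -polyCMn polyC_eq0 pnatr_eq0.
have l1 : 1 - l%:P != 0.
  by rewrite -polyC1 -polyCB polyC_eq0; case/and5P: gl.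
have near a b c (e w0 w1 w2 u : {poly K}) : [|| a, b | c] -> e != 0 ->
    curve l 0 = e * (a%:R)%:P + u * w0 -> curve l 1 = e * (b%:R)%:P + u * w1 ->
    curve l 2 = e * (c%:R)%:P + u * w2 -> u ^+ m %| mmap polyC (curve l) f.
  move=> abc e0 E0 E1 E2; pose w (i : 'I_3) := nth 0 [:: w0; w1; w2] i.
  have [q eq] := fA _ (bset_neq0 abc) e u w e0.
  rewrite (@eq_mmap _ _ _ _ polyC _ (fun i => e * (pt K (bset a b c) i)%:P + u * w i)) //.
    by rewrite eq dvdp_mulIl.
  by apply: ord3_ind; rewrite /pt inE.
move=> u; have := nz; rewrite /tangency => nz'.
set s : {poly K} := 'X in nz' near *; set t : {poly K} := 1 - s in nz' near *.
set X := qX _ s t in nz' near *; set Y := qY _ s t in nz' near *.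
set Z := qZ _ s t in nz' near *.
have s0 : s != 0 by apply: nz'; rewrite !inE eqxx ?orbT.
have t0 : t != 0 by apply: nz'; rewrite !inE eqxx ?orbT.
have st0 : s - l%:P * t != 0 by apply: nz'; rewrite !inE eqxx ?orbT.
have X0 : X != 0 by apply: nz'; rewrite !inE eqxx ?orbT.
have Y0 : Y != 0 by apply: nz'; rewrite !inE eqxx ?orbT.
have Z0 : Z != 0 by apply: nz'; rewrite !inE eqxx ?orbT.
rewrite !inE => /or4P[/eqP->|/eqP->|/eqP->|/or4P[/eqP->|/eqP->|/eqP->|/eqP->]].
(* In the linear cases the witnesses come from [X + Z = 2s(s - lt)], [Y + Z = 2t(s - lt)],
   [X + Y = 2st(1 - l)] and, for [s - t], from the differences of the quadrics. *)
- apply: (near true false false (X * (2 * t * (s - l%:P * t)))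
    0 (2 * Y * (s - l%:P * t)) (2 * Z * t * (1 - l%:P))); rewrite ?mulf_neq0 //=;
  by rewrite /quartic /= /X /Y /Z /qX /qY /qZ ?polyC1 ?polyC0; ring.
- apply: (near false true false (Y * (2 * s * (s - l%:P * t)))
    (2 * X * (s - l%:P * t)) 0 (2 * Z * s * (1 - l%:P))); rewrite ?mulf_neq0 //=;
  by rewrite /quartic /= /X /Y /Z /qX /qY /qZ ?polyC1 ?polyC0; ring.
- apply: (near true true true (X * (2 * t * (s - l%:P * t)))
    0 (- (2 * Z * (s - l%:P * t))) (2 * Y * l%:P * t)); rewrite ?mulf_neq0 //=;
  by rewrite /quartic /= /X /Y /Z /qX /qY /qZ ?polyC1 ?polyC0; ring.
- apply: (near false false true (Z * (2 * s * t * (1 - l%:P)))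
    (2 * X * t) (2 * Y * s) 0); rewrite ?mulf_neq0 //=;
  by rewrite /quartic /= /X /Y /Z /qX /qY /qZ ?polyC1 ?polyC0; ring.
(* For a quadric it is enough to collect the terms that contain it. *)
- apply: (near false true true (Y * Z) (Y + Z) Y Z); rewrite ?mulf_neq0 //=;
  by rewrite /quartic /= -/X -/Y -/Z ?polyC1 ?polyC0; ring.
- apply: (near true false true (X * Z) X (X + Z) Z); rewrite ?mulf_neq0 //=;
  by rewrite /quartic /= -/X -/Y -/Z ?polyC1 ?polyC0; ring.
- apply: (near true true false (X * Y) X Y (X + Y)); rewrite ?mulf_neq0 //=;
  by rewrite /quartic /= -/X -/Y -/Z ?polyC1 ?polyC0; ring.
Qed.

Lemma vanish_on_curve l d m f : generic l -> f \is d.-homog ->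
  (forall A, A != set0 -> vanish_order (pt K A) m f) -> (2 * d < 5 * m)%N ->
  mmap polyC (curve l) f = 0.
Proof.
move=> gl homf fA lt_dm; apply/eqP/negPn/negP => nz.
have := dvdp_leq nz (prod_exp_dvdp (tangency_coprime gl) (tangency_dvd gl fA)).
(* The product has degree 4 * 1 + 3 * 2 = 10, whereas the pullback of [f] has degree at most
   [4 * d]. *)
have szp : size (\prod_(u <- tang l) u) = 11%N.
  rewrite size_prod_seq => [|u]; last exact: tangency_neq0.
  by rewrite -(big_map (fun u : {poly K} => size u) predT id) (tangency_size gl) !big_cons big_nil.
have szh : (size (mmap polyC (curve l) f) <= (4 * d).+1)%N.
  apply: size_mmap_homog => // i.
  case: (tangency_size gl) => _ _ _ _ sX sY sZ.
  have szM (p q r : {poly K}) : size p = 3%N -> size q = 3%N -> size r = 3%N ->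
      (size (p * (q + r))%R <= 5)%N.
    move=> e1 e2 e3; apply: leq_trans (size_polyMleq _ _) _.
    by have := size_polyD q r; rewrite e1 e2 e3 maxnn; lia.
  by elim/ord3_ind: i; apply: (szM).
move=> /leq_trans /(_ szh); have := size_exp (\prod_(u <- tang l) u) m.
by rewrite szp /= => + le; set n := size _ in le * => e; lia.
Qed.

(** Undo the construction: [a], [b], [c] are the adapted coordinates, [X], [Y], [Z] their image
    under the Cremona map. Then [l] is read off from the equation of the conic and [x] from the
    projection ratio, with [s + t = 1]. *)
Lemma quartic_dense (v : 'I_3 -> K) :
  let a := v 1 + v 2 - v 0 in let b := v 0 + v 2 - v 1 in let c := v 0 + v 1 - v 2 in
  let X := b * c in let Y := a * c in let Z := a * b in
  a * b * c != 0 -> (X + Z) * (X - Z) * ((Y + Z) * (Y - Z)) * ((X + Y) * (X - Y)) != 0 ->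
  X ^+ 2 + Y ^+ 2 - 2 * Z ^+ 2 != 0 -> 3 * X ^+ 2 + Y ^+ 2 - 4 * Z ^+ 2 != 0 ->
  X ^+ 2 + 3 * Y ^+ 2 - 4 * Z ^+ 2 != 0 -> X + Y + 2 * Z != 0 ->
  exists l x k, [/\ generic l, k != 0 & quartic l x (1 - x) =1 (fun i => k * v i)].
Proof.
move=> a b c X Y Z abc0; rewrite !mulf_eq0 !negb_or.
case/andP => /andP[/andP[XZ XZ'] /andP[YZ YZ']] /andP[XY XY'] n1 n2 n3 n4.
have D0 : (Y + Z) * (Y - Z) != 0 by rewrite mulf_neq0.
pose l := (X + Z) * (X - Z) / ((Y + Z) * (Y - Z)).
pose x := (X + Z) / (X + Y + 2 * Z).
pose k0 := 2 * (X + Z) * (Y - X) / ((Y - Z) * (X + Y + 2 * Z) ^+ 2).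
have eX : qX l x (1 - x) = k0 * X by rewrite /qX /l /x /k0; field; rewrite n4 YZ YZ'.
have eY : qY l x (1 - x) = k0 * Y by rewrite /qY /l /x /k0; field; rewrite n4 YZ YZ'.
have eZ : qZ l x (1 - x) = k0 * Z by rewrite /qZ /l /x /k0; field; rewrite n4 YZ YZ'.
have two0 : (2 : K) != 0 by rewrite pnatr_eq0.
have YX : Y - X != 0 by rewrite -opprB oppr_eq0.
exists l, x, (2 * k0 ^+ 2 * (a * b * c)); split.
(* Multiplied by the denominator of [l], each genericity condition becomes one of the assumed
   inequalities or a product of them. *)
- have frac : l * ((Y + Z) * (Y - Z)) = (X + Z) * (X - Z) by rewrite /l divfK.
  have gen p q : q != 0 -> p * ((Y + Z) * (Y - Z)) = q -> p != 0.
    by move=> q0 e; apply: contra q0 => /eqP p0; rewrite -e p0 mul0r.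
  apply/and5P; split.
  + by apply: (gen _ ((X + Z) * (X - Z))); rewrite ?frac ?mulf_neq0.
  + by apply: (gen _ ((X + Y) * (Y - X))); rewrite ?mulf_neq0 // mulrBl frac; ring.
  + by apply: (gen _ (X ^+ 2 + Y ^+ 2 - 2 * Z ^+ 2)) => //; rewrite mulrDl frac; ring.
  + by apply: (gen _ (3 * X ^+ 2 + Y ^+ 2 - 4 * Z ^+ 2)) => //; rewrite mulrDl -mulrA frac; ring.
  + by apply: (gen _ (X ^+ 2 + 3 * Y ^+ 2 - 4 * Z ^+ 2)) => //; rewrite mulrDl frac; ring.
- have k00 : k0 != 0.
    by apply: mulf_neq0; [rewrite !mulf_neq0 | rewrite invr_neq0 // mulf_neq0 // expf_neq0].
  by rewrite mulf_neq0 // mulf_neq0 // expf_neq0.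
by apply: ord3_ind; rewrite /quartic /= eX eY eZ /X /Y /Z /a /b /c; ring.
Qed.

(** The product of [f] with the forms excluded in [quartic_dense] is nonzero, so some [v] avoids all
    their zeros; but a quartic of the pencil passes through [v], and [f] vanishes on it. *)
Lemma vanish_degree d m f : f != 0 -> f \is d.-homog ->
  (forall A, A != set0 -> vanish_order (pt K A) m f) -> (5 * m <= 2 * d)%N.
Proof.
move=> f0 homf fA; rewrite leqNgt; apply/negP => lt_dm.
pose a : {mpoly K[3]} := 'X_1 + 'X_2 - 'X_0; pose b : {mpoly K[3]} := 'X_0 + 'X_2 - 'X_1.
pose c : {mpoly K[3]} := 'X_0 + 'X_1 - 'X_2.
pose X := b * c; pose Y := a * c; pose Z := a * b.
pose gs : seq {mpoly K[3]} := [:: a * b * c;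
  (X + Z) * (X - Z) * ((Y + Z) * (Y - Z)) * ((X + Y) * (X - Y));
  X ^+ 2 + Y ^+ 2 - 2 * Z ^+ 2; 3 * X ^+ 2 + Y ^+ 2 - 4 * Z ^+ 2;
  X ^+ 2 + 3 * Y ^+ 2 - 4 * Z ^+ 2; X + Y + 2 * Z].
have horn v : [/\ a.@[v] = v 1 + v 2 - v 0, b.@[v] = v 0 + v 2 - v 1
    & c.@[v] = v 0 + v 1 - v 2].
  by rewrite /a /b /c !mevalB !mevalD !mevalXU.
clearbody a b c.
have mnat v n : (n%:R : {mpoly K[3]}).@[v] = n%:R by rewrite rmorph_nat.
have G0 : \prod_(g <- gs) g != 0.
  (* A sample point at which none of the excluded forms vanishes. *)
  pose v : 'I_3 -> K := fun i => nth 0 [:: 5; 4; 3] i.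
  have [va vb vc] := horn v.
  have {}va : a.@[v] = 2 by rewrite va /v /=; ring.
  have {}vb : b.@[v] = 4 by rewrite vb /v /=; ring.
  have {}vc : c.@[v] = 6 by rewrite vc /v /=; ring.
  apply/eqP => /(congr1 (meval v)) /eqP; rewrite meval0; apply/negP.
  rewrite rmorph_prod !big_cons big_nil mulr1 /X /Y /Z /=.
  rewrite !(mevalM, mevalD, mevalN, rmorphXn, meval1, mnat) /= va vb vc.
  have nz (x : K) k : x = k.+1%:R -> x != 0 by move=> ->; rewrite pnatr_eq0.
  rewrite !mulf_neq0 ?pnatr_eq0 //.
  - by apply: (nz _ 31); ring.
  - by apply: (nz _ 15); ring.
  - by apply: (nz _ 19); ring.
  - by apply: (nz _ 3); ring.
  - by apply: (nz _ 35); ring.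
  - by apply: (nz _ 11); ring.
  - by apply: (nz _ 591); ring.
  - by apply: (nz _ 1615); ring.
  - by apply: (nz _ 751); ring.
  - by apply: (nz _ 51); ring.
have [v] := mpoly_nonroot (mulf_neq0 f0 G0).
rewrite mevalM mulf_eq0 negb_or => /andP[fv].
have [va vb vc] := horn v.
rewrite rmorph_prod !big_cons big_nil mulr1 /X /Y /Z /=.
rewrite !(mevalM, mevalD, mevalN, rmorphXn, meval1, mnat) /= va vb vc.
rewrite mulf_eq0 negb_or => /andP[h1]; rewrite mulf_eq0 negb_or => /andP[h2].
rewrite mulf_eq0 negb_or => /andP[h3]; rewrite mulf_eq0 negb_or => /andP[h4].
rewrite mulf_eq0 negb_or => /andP[h5 h6].
have [l [x [k [gl k0 ev]]]] := quartic_dense h1 h2 h3 h4 h5 h6.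
have := congr1 (horner_eval x) (vanish_on_curve gl homf fA lt_dm).
rewrite rmorph_mmap rmorph0 (@eq_mmap _ _ _ _ idfun _ (fun i => k * v i)).
- rewrite (mmap_homog _ _ _ homf) => /eqP.
  by rewrite mulf_eq0 expf_eq0 (negbTE k0) andbF /= (negbTE fv).
- by move=> c'; rewrite /= /horner_eval hornerC.
move=> i; rewrite -ev /= /horner_eval; elim/ord3_ind: i; rewrite /quartic /=;
  by rewrite hornerM [X in _ * X]hornerD ?horner_qX ?horner_qY ?horner_qZ.
Qed.

End DegreeBound.

(** * A form of degree 15 with multiplicity 6 *)

Section SixFold.
Variables (T : comNzRingType) (I P : T -> Prop).
Hypotheses (idI : is_ideal I) (primeP : prime_ideal P) (IP : Defs.subsetI I P).
Implicit Types x y z : T.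

Definition six_fold (S : comNzRingType) (x y z : S) : S :=
  (x * y * z * (x - y) * (y - z) * (z - x)) ^+ 2 * ((x + y - z) * (x - y + z) * (y + z - x)).

Lemma six_fold_rot (S : comNzRingType) (x y z : S) : six_fold x y z = six_fold y z x.
Proof. rewrite /six_fold; ring. Qed.

Lemma prime_idealN a b : ~ P a -> ~ P b -> ~ P (a * b).
Proof. by move=> Pa Pb /(primeP.2.2) []. Qed.

Lemma prime_idealNX a n : ~ P a -> ~ P (a ^+ n).
Proof.
move=> Pa; elim: n => [|n IHn]; first exact: primeP.2.1.
by rewrite exprS; apply: prime_idealN.
Qed.

Lemma prime_ideal_subN a b : ~ P a -> P b -> ~ P (a - b).
Proof. by move=> Pa Pb Pab; apply: Pa; rewrite -(subrK b a); apply: primeP.1.2.1. Qed.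

Lemma six_factors s r a1 a2 a3 a4 a5 a6 :
  I (s * a1) -> I (s * a2) -> I (s * a3) -> I (s * a4) -> I (s * a5) -> I (s * a6) ->
  ideal_pow I 6 (s ^+ 6 * (a1 * a2 * a3 * a4 * a5 * a6 * r)).
Proof.
move=> I1 I2 I3 I4 I5 I6.
rewrite (_ : _ * _ = s * a1 * (s * a2 * (s * a3 * (s * a4 * (s * a5 * (s * a6 * r)))))); last by ring.
by do 6!apply: ideal_powS => //; apply: ideal_pow0.
Qed.

Definition cubics_in x y z := [/\ I (x * y * (x - y)), I (y * z * (y - z)) & I (z * x * (z - x))].

(** The cases, by which of [y], [z] lie in [P], correspond to the types of points. In each, six
    factors of the form, counted with multiplicity, are carried into [I] by one multiplier [s]
    outside [P]. *)
Lemma six_fold_local x y z : cubics_in x y z -> ~ P x ->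
  exists s, ~ P s /\ ideal_pow I 6 (s * six_fold x y z).
Proof.
have Iadd a b : I a -> I b -> I (a + b) by apply: idI.2.1.
have Imul a r b : I a -> b = r * a -> I b by move=> Ia ->; apply: idI.2.2.
move=> [Ixy Iyz Izx] Px.
have sub a b : I (a * b * (a - b)) -> ~ P a -> ~ P b -> P (a - b).
  by move=> /IP /(primeP.2.2) [/(primeP.2.2) []|].
(* Points with two nonzero coordinates: the doubled lines [c] and [a - b] and two of the simple
   lines pass through. *)
have two a b c : I (a * b * (a - b)) -> I (b * c * (b - c)) -> I (c * a * (c - a)) ->
    ~ P a -> ~ P b -> P c -> exists s, ~ P s /\ ideal_pow I 6 (s * six_fold a b c).
  move=> Iab Ibc Ica Pa Pb Pc; pose s := a * (c - a) * (a * b).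
  have Is1 : I (s * c) by apply: (Imul _ (a * b) _ Ica); rewrite /s; ring.
  have Is2 : I (s * (a - b)) by apply: (Imul _ (a * (c - a)) _ Iab); rewrite /s; ring.
  have Is3 : I (s * (a - b + c)) by rewrite mulrDr; apply: Iadd.
  have Is4 : I (s * (b + c - a)).
    by rewrite (_ : _ * _ = s * c - s * (a - b)); [apply: ideal_sub | ring].
  exists (s ^+ 6); split.
    apply: prime_idealNX; apply: prime_idealN; last exact: prime_idealN.
    apply: prime_idealN => //; rewrite -opprB => /(ideal_opp primeP.1); rewrite opprK.
    exact: prime_ideal_subN.
  have := six_factors ((a * b * (b - c) * (c - a)) ^+ 2 * (a + b - c)) Is1 Is1 Is2 Is2 Is3 Is4.
  by congr (ideal_pow I 6 (_ * _)); rewrite /six_fold; ring.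
have [Py|Py] := classic (P y); have [Pz|Pz] := classic (P z).
(* A coordinate point: the doubled lines [y], [z] and [y - z] pass through. *)
- pose s := x * (x - y) * (z - x).
  have Is1 : I (s * y) by apply: (Imul _ (z - x) _ Ixy); rewrite /s; ring.
  have Is2 : I (s * z) by apply: (Imul _ (x - y) _ Izx); rewrite /s; ring.
  have Is3 : I (s * (y - z)) by rewrite mulrBr; apply: ideal_sub.
  exists (s ^+ 6); split.
    apply: prime_idealNX; apply: prime_idealN.
      by apply: prime_idealN => //; apply: prime_ideal_subN.
    rewrite -opprB => /(ideal_opp primeP.1); rewrite opprK.
    exact: prime_ideal_subN.
  have := six_factors ((x * (x - y) * (z - x)) ^+ 2 * ((x + y - z) * (x - y + z) * (y + z - x)))
    Is1 Is1 Is2 Is2 Is3 Is3.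
  by congr (ideal_pow I 6 (_ * _)); rewrite /six_fold; ring.
- have [s [Ps Is]] := two z x y Izx Ixy Iyz Pz Px Py.
  by exists s; rewrite six_fold_rot in Is.
- by apply: two.
(* The point (1, 1, 1): the three doubled lines given by differences pass through. *)
pose s := x * y * z.
have Is1 : I (s * (x - y)) by apply: (Imul _ z _ Ixy); rewrite /s; ring.
have Is2 : I (s * (y - z)) by apply: (Imul _ x _ Iyz); rewrite /s; ring.
have Is3 : I (s * (z - x)) by apply: (Imul _ y _ Izx); rewrite /s; ring.
exists (s ^+ 6); split; first by apply: prime_idealNX; do !apply: prime_idealN.
have := six_factors ((x * y * z) ^+ 2 * ((x + y - z) * (x - y + z) * (y + z - x)))
  Is1 Is1 Is2 Is2 Is3 Is3.
by congr (ideal_pow I 6 (_ * _)); rewrite /six_fold; ring.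
Qed.

End SixFold.

(** * Containments between symbolic and ordinary powers *)

Section Containments.
Variable K : numClosedFieldType.
Implicit Types f : {mpoly K[3]}.

(** If all variables multiplied the witness [f] into the ideal, then [f] would lie in every point
    ideal, since some variable is nonzero at each point; so [f] would be in the ideal and [P] would
    contain 1. *)
Lemma assoc_prime_var P : associated_prime (@seven_ideal K) P -> exists i, ~ P 'X_i.
Proof.
move=> [[idP [P1 primeP]] [f Pf]]; apply: not_all_ex_not => PX; apply: P1; apply/Pf.
rewrite mul1r; apply: seven_ideal_bigcap => A /[dup] A0 /set0Pn [i iA].
have [_ [_ primeA]] := point_ideal_prime K A0.
have homX : ('X_i : {mpoly K[3]}) \is 1.-homog by rewrite dhomogX /= mdeg1.
have /Pf /(seven_ideal_sub_point A) /primeA [|//] := PX i.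
move/(point_ideal_homog _ homX); rewrite mevalXU /pt iA => /eqP.
by rewrite oner_eq0.
Qed.

Definition low_form : {mpoly K[3]} := six_fold 'X_0 'X_1 'X_2.

Lemma symb_pow_low_form n : symb_pow seven_ideal (6 * n) (low_form ^+ n).
Proof.
move=> P assP; have [primeP [f Pf]] := assP.
have JP : Defs.subsetI seven_ideal P.
  by move=> g Jg; apply/Pf; apply: ideal_mulr.
have [i Pi] := assoc_prime_var assP.
have [s [Ps Js]] : exists s, ~ P s /\ ideal_pow seven_ideal 6 (s * low_form).
  have J01 := seven_ideal_var K 0 1; have J12 := seven_ideal_var K 1 2.
  have J20 := seven_ideal_var K 2 0.
  (* By cyclic symmetry the variable outside [P] may be placed first. *)
  rewrite /low_form; elim/ord3_ind: i Pi => Pi.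
  - by apply: six_fold_local Pi.
  - by rewrite six_fold_rot; apply: six_fold_local Pi.
  - by rewrite -six_fold_rot; apply: six_fold_local Pi.
exists (s ^+ n); split; first exact: prime_idealNX.
by rewrite -exprMn; apply: ideal_pow_exp.
Qed.

(** Restrict to the line through the origin and (1, 2, 4), where the form is nonzero: its power has
    order exactly [15 * n] at the origin, while elements of the [r]-th power have order at least
    [3 * r]. *)
Lemma low_form_notin n r : (5 * n < r)%N -> ~ ideal_pow seven_ideal r (low_form ^+ n).
Proof.
move=> lt_nr; pose v (i : 'I_3) : K := nth 0 [:: 1; 2; 4] i.
pose phi : {rmorphism {mpoly K[3]} -> {poly K}} := mmap polyC (fun i => 'X * (v i)%:P).
have phi_cubic g : seven_ideal g -> exists q, phi g = 'X^3 * q.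
  apply: seven_ideal_map => i j; exists ((v i)%:P * (v j)%:P * ((v i)%:P - (v j)%:P)).
  by rewrite !rmorphM rmorphB /= !mmapX !mmap1U; ring.
move=> /(ideal_pow_map phi_cubic) [q].
have -> : phi (low_form ^+ n) = 'X^(15 * n) * ((six_fold 1 2 4) ^+ n)%:P.
  rewrite rmorphXn exprM polyC_exp -exprMn; congr (_ ^+ _).
  rewrite /low_form /six_fold !(rmorphM, rmorphXn, rmorphB, rmorphD) /= !mmapX !mmap1U /v /=.
  by rewrite !(polyCMn, polyC1); ring.
move=> /(congr1 (fun p : {poly K} => p`_(15 * n))); rewrite -exprM !coefXnM ltnn subnn coefC /=.
rewrite (_ : (_ < 3 * r)%N) => [/eqP|]; last by lia.
apply/negP; apply: expf_neq0.
rewrite (_ : six_fold _ _ _ = - (2 ^+ 8 * 3 ^+ 3 * 5) :> K); last by rewrite /six_fold; ring.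
by rewrite oppr_eq0 !mulf_neq0 ?expf_neq0 ?pnatr_eq0.
Qed.

Lemma symb_pow_sub m r f : (6 * r < 5 * m)%N ->
  symb_pow seven_ideal m f -> ideal_pow seven_ideal r f.
Proof.
move=> lt_rm fm; rewrite (@pihomog_partitionE _ _ mdeg (msize f) f (leqnn _)).
have idJ := ideal_pow_ideal (@seven_ideal K) r.
apply: ideal_sum => // d; have homf := pihomogP mdeg d f.
have [->|f0] := eqVneq (pihomog mdeg d f) 0; first exact: idJ.1.
have fA A : A != set0 -> vanish_order (pt K A) m (pihomog mdeg d f).
  by move=> A0; apply: symb_pow_vanish_order.
have := vanish_degree f0 homf fA => le_md.
apply: (vanish_order_ideal_pow (d := d)) => // [|A A0]; first by lia.
by apply: vanish_order_leq (fA A A0); lia.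
Qed.

End Containments.

(** * The two suprema *)

Lemma ratio_le m r : (0 < r)%N -> (5 * m <= 6 * r)%N ->
  Rle (Rdiv (INR m) (INR r)) (Rdiv (INR 6) (INR 5)).
Proof.
move=> /ssrnat.ltP /lt_0_INR r0 /ssrnat.leP /le_INR; rewrite -!multE !mult_INR => le_mr.
apply: (Rmult_le_reg_r _ _ _ r0); rewrite /Rdiv Rmult_assoc Rinv_l; last by lra.
by simpl INR in *; lra.
Qed.

(** The ratio falls short of 6/5 by [6 / (5 * (5n + 1))], less than [1 / n]; a smaller bound [b] is
    refuted by an [n] with [1 / n] below [6/5 - b]. *)
Lemma ratio_lub (b : Rdefinitions.R) :
  (forall n, (0 < n)%N -> Rle (Rdiv (INR (6 * n)) (INR (5 * n + 1))) b) ->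
  Rle (Rdiv (INR 6) (INR 5)) b.
Proof.
move=> ub; apply: Rnot_lt_le => lt_b.
have [n [lt_n /ssrnat.ltP n0]] := archimed_cor1 _ (Rlt_Rminus _ _ lt_b).
have x0 := lt_0_INR n (ssrnat.ltP n0); have := ub n n0.
rewrite -plusE -!multE plus_INR !mult_INR; set x := INR n in lt_n x0 *; clearbody x.
have xy := Rinv_r x (Rgt_not_eq _ _ x0); have y0 := Rinv_0_lt_compat _ x0.
set y := Rinv x in lt_n xy y0; set D := Rplus _ _; set c := Rdiv _ _ in lt_n lt_b.
have D0 : Rlt R0 D by rewrite /D; simpl INR; lra.
have -> : Rdiv (Rmult (INR 6) x) D = Rmult (Rmult (INR 6) x) (Rinv D) by [].
move=> /(Rmult_le_compat_r D _ _ (Rlt_le _ _ D0)).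
rewrite Rmult_assoc Rinv_l; last by lra.
have := Rmult_lt_compat_r D _ _ D0 lt_n.
have -> : Rmult y D = Rplus (INR 5) y.
  by rewrite /D Rmult_plus_distr_l -Rmult_assoc (Rmult_comm y) Rmult_assoc
    (Rmult_comm y) xy /=; lra.
have -> : Rmult (Rminus c b) D = Rminus (Rplus (Rmult (INR 6) x) c) (Rmult b D).
  by rewrite /D /c !INR_IZR_INZ /=; lra.
by rewrite /c !INR_IZR_INZ /=; lra.
Qed.

Lemma seven_ideal_resurgence (K : numClosedFieldType) :
  resurgence_is (@seven_ideal K) (Rdiv (INR 6) (INR 5)) /\
  asym_resurgence_is (@seven_ideal K) (Rdiv (INR 6) (INR 5)).
Proof.
have le_of_nsub m r : ~ Defs.subsetI (symb_pow (@seven_ideal K) m) (ideal_pow seven_ideal r) ->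
    (5 * m <= 6 * r)%N.
  by move=> nsub; rewrite leqNgt; apply/negP => lt_rm; apply: nsub => f; apply: symb_pow_sub.
(* The 1 added to [5 * n] puts the degree [15 * n * t] below [3 * (5 * n + 1) * t] for all positive
   [t] at once, so the same ratios bound both suprema from below. *)
have nsub n t : (0 < t)%N -> ~ Defs.subsetI (symb_pow (@seven_ideal K) (6 * n * t))
    (ideal_pow seven_ideal ((5 * n + 1) * t)).
  move=> t0 /(_ (low_form K ^+ (n * t))); rewrite -mulnA => /(_ (@symb_pow_low_form K _)).
  by apply: low_form_notin; rewrite mulnA mulnDl mul1n -{1}[(5 * n * t)%N]addn0 ltn_add2l.
split; split.
- by move=> _ [m [r [m0 [r0 [/le_of_nsub le_mr ->]]]]]; apply: ratio_le.
- move=> b ub; apply: ratio_lub => n n0; apply: ub; exists (6 * n)%N, (5 * n + 1)%N.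
  split; first by rewrite muln_gt0.
  split; first by rewrite addn1.
  by split=> //; have := nsub n 1%N; rewrite !muln1; apply.
- move=> _ [m [r [m0 [r0 [[t0 nsubt] ->]]]]]; apply: ratio_le => //.
  (* One positive [t] past the threshold is enough, as it cancels from the inequality. *)
  have := le_of_nsub _ _ (nsubt t0.+1 (leqnSn _)).
  by rewrite !mulnA leq_pmul2r.
move=> b ub; apply: ratio_lub => n n0; apply: ub; exists (6 * n)%N, (5 * n + 1)%N.
split; first by rewrite muln_gt0.
split; first by rewrite addn1.
by split=> //; exists 1%N => t t0; apply: nsub.
Qed.

Theorem theorem4p3 :
  resurgence_is J (Rdiv (INR 6) (INR 5)) /\ asym_resurgence_is J (Rdiv (INR 6) (INR 5)).
Proof. exact: (seven_ideal_resurgence Rdefinitions.R[i]). Qed.
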